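(* Work in the ring $\hat\Lambda=\mathbb{Q}[[p_1,p_2,\ldots]]$ of symmetric series, where $p_n$ is the $n$-th power sum symmetric function, equipped with the Kronecker product $\otimes$ defined on power sum products by $p_\lambda\otimes p_\mu=\delta_{\lambda\mu}z_\lambda p_\lambda$ and extended bilinearly (degree by degree) to $\hat\Lambda$. Define \[ \mathsf{H}=\sum_{n\ge0}h_n=\exp\Big(\sum_{n\ge1}\frac{p_n}{n}\Big),\qquad \mathsf{E}=\sum_{n\ge0}e_n=\exp\Big(\sum_{n\ge1}(-1)^{n+1}\frac{p_n}{n}\Big), \] \[ \mathsf{S}=\sum_{\lambda}s_\lambda=\exp\Big(\sum_{n\ge1}\Big(\frac{p_n^2}{2n}+\frac{p_{2n-1}}{2n-1}\Big)\Big), \] (the sum over all partitions $\lambda$, including the empty one), and the products $\mathsf{S}\mathsf{H}^{-1}$ and $\mathsf{S}\mathsf{E}^{-1}$ in $\hat\Lambda$. Further define \[ \mathsf{M}_{odd}=\exp\Big(\sum_{n\ \mathrm{odd}}\frac{p_n}{n(1-p_n)}\Big),\quad \mathsf{M}_{even}=\exp\Big(\sum_{n\ \mathrm{even}}\frac{p_n}{n(1-p_n)}\Big),\quad \mathsf{N}=\exp\Big(\sum_{n\ge1}\frac{p_n^2}{2n(1-p_n^2)}\Big), \] \[ \mathsf{P}=\exp\Big(-\sum_{n\ \mathrm{even}}\frac{p_n}{n(1+p_n)}\Big),\qquad \mathsf{G}=\prod_{n\ge1}(1-p_n^2)^{-1/2}. \] Then the following Kronecker product identities hold (and, $\otimes$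 being commutative, also with the factors swapped): \begin{align*} &\mathsf{H}\otimes\mathsf{H}=\mathsf{H},\quad \mathsf{H}\otimes\mathsf{E}=\mathsf{E},\quad \mathsf{H}\otimes\mathsf{S}=\mathsf{S},\quad \mathsf{H}\otimes\mathsf{S}\mathsf{H}^{-1}=\mathsf{S}\mathsf{H}^{-1},\quad \mathsf{H}\otimes\mathsf{S}\mathsf{E}^{-1}=\mathsf{S}\mathsf{E}^{-1},\\ &\mathsf{E}\otimes\mathsf{E}=\mathsf{H},\quad \mathsf{E}\otimes\mathsf{S}=\mathsf{S},\quad \mathsf{E}\otimes\mathsf{S}\mathsf{H}^{-1}=\mathsf{S}\mathsf{E}^{-1},\quad \mathsf{E}\otimes\mathsf{S}\mathsf{E}^{-1}=\mathsf{S}\mathsf{H}^{-1},\\ &\mathsf{S}\otimes\mathsf{S}=\mathsf{G}\,\mathsf{M}_{odd},\quad \mathsf{S}\otimes\mathsf{S}\mathsf{H}^{-1}=\mathsf{G}\,\mathsf{N},\quad \mathsf{S}\otimes\mathsf{S}\mathsf{E}^{-1}=\mathsf{G}\,\mathsf{N},\\ &\mathsf{S}\mathsf{H}^{-1}\otimes\mathsf{S}\mathsf{H}^{-1}=\mathsf{G}\,\mathsf{M}_{even},\quad \mathsf{S}\mathsf{H}^{-1}\otimes\mathsf{S}\mathsf{E}^{-1}=\mathsf{G}\,\mathsf{P},\quad \mathsf{S}\mathsf{E}^{-1}\otimes\mathsf{S}\mathsf{E}^{-1}=\mathsf{G}\,\mathsf{M}_{even}. \end{align*}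
   Context: $h_n$, $e_n$, $s_\lambda$ denote the complete, elementary and Schur symmetric functions; $p_\lambda=p_{\lambda_1}\cdots p_{\lambda_k}$; for $\lambda=[1^{r_1}2^{r_2}\cdots]$ (i.e. $\lambda$ has $r_i$ parts equal to $i$), $z_\lambda=\prod_i i^{r_i}r_i!$. All exponentials, inverses and the product defining $\mathsf{G}$ are taken as formal power series in $\hat\Lambda$, where $(1-p_n^2)^{-1/2}=\sum_{k\ge0}\binom{2k}{k}4^{-k}p_n^{2k}$. *)

(* Defs.v *)
From HB Require Import structures.
From mathcomp Require Import all_boot all_order all_algebra.
From mathcomp Require Import boolp classical_sets fsbigop zify.

Set Implicit Arguments.
Unset Strict Implicit.
Unset Printing Implicit Defensive.

Import GRing.Theory.
Local Open Scope ring_scope.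

(* Integer partitions: weakly decreasing sequences of positive parts. *)
Definition is_part (s : seq nat) := sorted geq s && (0%N \notin s).

Record part := Part { parts :> seq nat; _ : is_part parts }.
HB.instance Definition _ := [isSub for parts].
HB.instance Definition _ := [Choice of part by <:].

Implicit Types l m : part.

Definition psize l : nat := sumn l.

Lemma pempty_subproof : is_part [::]. Proof. by []. Qed.
Definition pempty := Part pempty_subproof.

Lemma punion_subproof l m : is_part (sort geq (l ++ m)).
Proof.
case: l m => [s /andP[_ s0]] [t /andP[_ t0]] /=.
rewrite /is_part sort_sorted => [|x y]; last exact: leq_total.
by rewrite mem_sort mem_cat negb_or s0.
Qed.
(* The partition whose multiset of parts is the sum of those of l and m, so
   that p_l * p_m = p_(punion l m). *)
Definition punion l m := Part (punion_subproof l m).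

Lemma punionE l m : perm_eq (punion l m) (l ++ m).
Proof. by rewrite perm_sort. Qed.

Lemma part_inj l m : perm_eq l m -> l = m.
Proof.
case: l m => [s sP] [t tP] /= pst; apply: val_inj => /=.
have [/andP[s1 _] /andP[t1 _]] := (sP, tP).
apply: (sorted_eq _ _ s1 t1 pst) => [y x z xy yz|x y].
  exact: leq_trans yz xy.
by rewrite andbC => /anti_leq.
Qed.

Lemma punionC : commutative punion.
Proof.
move=> l m; apply: part_inj; apply: (perm_trans (punionE l m)).
by rewrite perm_catC perm_sym punionE.
Qed.

Lemma punionA : associative punion.
Proof.
move=> l m n; apply: part_inj.
apply: (perm_trans (punionE _ _)); rewrite perm_sym.
apply: (perm_trans (punionE _ _)); rewrite perm_sym.
apply: (@perm_trans _ (l ++ m ++ n)); first by rewrite perm_cat2l punionE.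
by rewrite catA perm_cat2r perm_sym punionE.
Qed.

Lemma punion0l : left_id pempty punion.
Proof. by move=> l; apply: part_inj; rewrite (perm_trans (punionE _ _)). Qed.

Lemma psizeU l m : psize (punion l m) = (psize l + psize m)%N.
Proof. by rewrite /psize (perm_sumn (punionE l m)) sumn_cat. Qed.

Fixpoint words (A : seq nat) (k : nat) : seq (seq nat) :=
  if k is k'.+1 then [::] :: [seq a :: w | a <- A, w <- words A k']
  else [:: [::]].

(* A duplicate-free list containing all partitions of size at most d. *)
Definition parts_upto (d : nat) : seq part :=
  [seq l <- undup (pmap insub (words (iota 0 d.+1) d)) | (psize l <= d)%N].

Lemma mem_words (A s : seq nat) k :
  (size s <= k)%N -> {subset s <= A} -> s \in words A k.
Proof.
elim: k s => [|k IH] [|a s] //= ks sA.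
rewrite inE /=; apply/allpairsP; exists (a, s); split=> //=.
  by apply: sA; rewrite mem_head.
by apply: IH => // x xs; apply: sA; rewrite inE xs orbT.
Qed.

Lemma mem_parts_upto d l : (l \in parts_upto d) = (psize l <= d)%N.
Proof.
rewrite mem_filter andb_idr // => ld.
rewrite mem_undup mem_pmap_sub; case: l ld => s sP; rewrite /psize /= => sd.
have /andP[_ s0] := sP; apply: mem_words.
  apply: leq_trans sd; elim: s s0 {sP} => //= a s IH.
  by rewrite inE negb_or eq_sym -lt0n => /andP[a0 /IH]; lia.
move=> x xs; rewrite (mem_iota 0 d.+1) add0n ltnS; apply: leq_trans sd.
by elim: s xs {sP s0} => //= a s IH; rewrite inE => /orP[/eqP->|/IH]; lia.
Qed.

Lemma parts_upto_uniq d : uniq (parts_upto d).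
Proof. by rewrite filter_uniq ?undup_uniq. Qed.

(* The ring Q[[p_1, p_2, ...]]: a series is the family of its coefficients on
   the monomials p_l, indexed by partitions l. *)
Record symser := SymSer { coef : part -> rat }.

HB.instance Definition _ := gen_eqMixin symser.
HB.instance Definition _ := gen_choiceMixin symser.

Implicit Types f g h : symser.

Lemma symserP f g : (forall l, coef f l = coef g l) -> f = g.
Proof. by case: f g => [f] [g] /= fg; congr SymSer; apply: funext. Qed.

Definition ser0 := SymSer (fun=> 0).
Definition ser_opp f := SymSer (fun l => - coef f l).
Definition ser_add f g := SymSer (fun l => coef f l + coef g l).
Definition ser1 := SymSer (fun l => (l == pempty)%:R).
Definition ser_mul f g := SymSer (fun l =>
  \sum_(x \in [set x : part * part | punion x.1 x.2 = l])
     coef f x.1 * coef g x.2).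
Definition ser_scale (a : rat) f := SymSer (fun l => a * coef f l).

Lemma coef_ser_mul d f g l : (psize l <= d)%N ->
  coef (ser_mul f g) l =
  \sum_(a <- parts_upto d) \sum_(b <- parts_upto d)
     (punion a b == l)%:R * (coef f a * coef g b).
Proof.
move=> ld /=; set r := [seq x <- [seq (a, b) | a <- parts_upto d,
  b <- parts_upto d] | punion x.1 x.2 == l].
have mr (x : part * part) : punion x.1 x.2 = l -> x \in r.
  case: x => a b /= abl; rewrite mem_filter /= abl eqxx /=.
  by apply/allpairsP; exists (a, b); rewrite !mem_parts_upto /=;
    split=> //; move: ld; rewrite -abl psizeU; lia.
rewrite (@fsbigE _ _ _ _ _ r).
- rewrite big_filter_cond big_mkcond big_allpairs; apply: eq_bigr => a _.
  apply: eq_bigr => b _; rewrite andb_idr; last by move=> /eqP ?; rewrite inE.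
  by case: eqP => _; rewrite ?mul1r ?mul0r.
- rewrite filter_uniq // allpairs_uniq ?parts_upto_uniq //.
  by move=> [a b] [a' b'].
- by move=> x /=; rewrite mem_filter => /andP[/eqP].
- by move=> x /= /mr xr /negP; rewrite xr.
Qed.

Lemma sum_parts_upto1 d l (F : part -> rat) :
  \sum_(a <- parts_upto d) (l == a)%:R * F a = (psize l <= d)%:R * F l.
Proof.
have [ld|ld] := leqP.
  rewrite (bigD1_seq l) ?mem_parts_upto ?parts_upto_uniq //= eqxx !mul1r.
  by rewrite big1 ?addr0 // => a; rewrite eq_sym => /negPf->; rewrite mul0r.
rewrite mul0r big_seq big1 // => a; rewrite mem_parts_upto => ad.
by case: eqP ad ld => [->|]; rewrite ?mul0r // leqNgt => /negPf->.
Qed.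

Lemma ser_mulC : commutative ser_mul.
Proof.
move=> f g; apply: symserP => l; rewrite !(@coef_ser_mul (psize l)) //.
rewrite exchange_big; apply: eq_bigr => a _; apply: eq_bigr => b _.
by rewrite punionC [coef f _ * _]mulrC.
Qed.

Lemma coef_ser_mull f g h l : coef (ser_mul (ser_mul f g) h) l =
  \sum_(a <- parts_upto (psize l)) \sum_(b <- parts_upto (psize l))
  \sum_(c <- parts_upto (psize l))
     (punion (punion a b) c == l)%:R * (coef f a * coef g b * coef h c).
Proof.
rewrite (@coef_ser_mul (psize l)) //; set P := parts_upto _.
transitivity (\sum_(x <- P) \sum_(c <- P) \sum_(a <- P) \sum_(b <- P)
    (punion a b == x)%:R *
      ((punion x c == l)%:R * (coef f a * coef g b * coef h c))).
  rewrite big_seq [RHS]big_seq; apply: eq_bigr => x.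
  rewrite mem_parts_upto => xl; apply: eq_bigr => c _.
  rewrite (coef_ser_mul f g xl) mulr_suml mulr_sumr; apply: eq_bigr => a _.
  rewrite mulr_suml mulr_sumr; apply: eq_bigr => b _.
  by rewrite -mulrA mulrCA.
under eq_bigr => x _ do rewrite exchange_big.
rewrite exchange_big; apply: eq_bigr => a _.
under eq_bigr => x _ do rewrite exchange_big.
rewrite exchange_big; apply: eq_bigr => b _.
rewrite exchange_big; apply: eq_bigr => c _.
rewrite sum_parts_upto1; case: (leqP (psize _)) => h1; first by rewrite mul1r.
rewrite mul0r; case: eqP => [el|]; last by rewrite mul0r.
by move: h1; rewrite -el !psizeU; lia.
Qed.

Lemma ser_mulA : associative ser_mul.
Proof.
move=> f g h; rewrite ser_mulC; apply: symserP => l; rewrite !coef_ser_mull.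
under eq_bigr => a _ do rewrite exchange_big.
rewrite exchange_big; apply: eq_bigr => c _; apply: eq_bigr => a _.
apply: eq_bigr => b _; congr (_ * _); last by rewrite mulrC mulrA.
by rewrite [punion _ c]punionC punionA.
Qed.

Lemma ser_mul1 : left_id ser1 ser_mul.
Proof.
move=> f; apply: symserP => l; rewrite (@coef_ser_mul (psize l)) //.
rewrite exchange_big (bigD1_seq l) ?mem_parts_upto ?parts_upto_uniq //=.
rewrite [X in _ + X]big1 ?addr0 => [|b bl].
  rewrite (bigD1_seq pempty) ?mem_parts_upto ?parts_upto_uniq //=.
  by rewrite punion0l !eqxx !mul1r big1 ?addr0 // => a /negPf->;
    rewrite mul0r mulr0.
apply: big1 => a _; case: (eqVneq a pempty) => [->|]; last first.
  by rewrite mul0r mulr0.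
by rewrite punion0l (negPf bl) mul0r.
Qed.

Lemma ser_mulDl : left_distributive ser_mul ser_add.
Proof.
move=> f g h; apply: symserP => l.
rewrite -[RHS]/(coef (ser_mul f h) l + coef (ser_mul g h) l).
rewrite !(@coef_ser_mul (psize l)) //=.
rewrite -[RHS]big_split; apply: eq_bigr => a _ /=.
rewrite -[RHS]big_split; apply: eq_bigr => b _ /=.
by rewrite mulrDl mulrDr.
Qed.

Lemma ser_addA : associative ser_add.
Proof. by move=> f g h; apply: symserP => l /=; rewrite addrA. Qed.
Lemma ser_addC : commutative ser_add.
Proof. by move=> f g; apply: symserP => l /=; rewrite addrC. Qed.
Lemma ser_add0 : left_id ser0 ser_add.
Proof. by move=> f; apply: symserP => l /=; rewrite add0r. Qed.
Lemma ser_addN : left_inverse ser0 ser_opp ser_add.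
Proof. by move=> f; apply: symserP => l /=; rewrite addNr. Qed.

HB.instance Definition _ :=
  GRing.isZmodule.Build symser ser_addA ser_addC ser_add0 ser_addN.

Lemma ser1_neq0 : ser1 != 0 :> symser.
Proof.
apply/eqP => /(congr1 (fun f => coef f pempty)) /=.
by move/eqP; rewrite ?eqxx oner_eq0.
Qed.

HB.instance Definition _ := GRing.Zmodule_isComNzRing.Build symser
  ser_mulA ser_mulC ser_mul1 ser_mulDl ser1_neq0.

Lemma ser_scaleA a b f : ser_scale a (ser_scale b f) = ser_scale (a * b) f.
Proof. by apply: symserP => l /=; rewrite mulrA. Qed.
Lemma ser_scale1 : left_id 1 ser_scale.
Proof. by move=> f; apply: symserP => l /=; rewrite mul1r. Qed.
Lemma ser_scaleDr : right_distributive ser_scale +%R.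
Proof. by move=> a f g; apply: symserP => l /=; rewrite mulrDr. Qed.
Lemma ser_scaleDl f : {morph ser_scale^~ f : a b / a + b}.
Proof. by move=> a b; apply: symserP => l /=; rewrite mulrDl. Qed.

HB.instance Definition _ := GRing.Zmodule_isLmodule.Build rat symser
  ser_scaleA ser_scale1 ser_scaleDr ser_scaleDl.

Lemma ser_scaleAl (a : rat) f g : a *: (f * g) = (a *: f) * g.
Proof.
apply: symserP => l.
rewrite -[LHS]/(a * coef (ser_mul f g) l) -[RHS]/(coef (ser_mul _ _) l).
rewrite !(@coef_ser_mul (psize l)) // mulr_sumr; apply: eq_bigr => b _.
rewrite mulr_sumr; apply: eq_bigr => c _ /=.
by rewrite mulrCA !mulrA.
Qed.

HB.instance Definition _ :=
  GRing.Lmodule_isLalgebra.Build rat symser ser_scaleAl.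
HB.instance Definition _ := GRing.Lalgebra_isComAlgebra.Build rat symser.

Definition ser_unit : pred symser := fun f => `[< exists g, g * f = 1 >].
Definition ser_inv f : symser :=
  if pselect (exists g, g * f = 1) is left fP then projT1 (cid fP) else f.

Lemma ser_mulVr : {in ser_unit, left_inverse 1 ser_inv *%R}.
Proof.
move=> f /asboolP fP; rewrite /ser_inv; case: pselect => // fP'.
by case: cid.
Qed.
Lemma ser_unitP f g : g * f = 1 -> ser_unit f.
Proof. by move=> fg; apply/asboolP; exists g. Qed.
Lemma ser_inv_out : {in [predC ser_unit], ser_inv =1 id}.
Proof.
move=> f /asboolP fP; rewrite /ser_inv; case: pselect => // fP'.
Qed.

HB.instance Definition _ := GRing.ComNzRing_hasMulInverse.Build symser
  ser_mulVr ser_unitP ser_inv_out.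

(* The power sum p_n for n >= 1; psum 0 = 0. *)
Definition psum (n : nat) : symser :=
  SymSer (fun l => (parts l == [:: n])%:R).

Definition psump l : symser := \prod_(i <- l) psum i.

Definition zpart l : nat :=
  (\prod_(i <- undup l) (i ^ count_mem i l * (count_mem i l)`!))%N.

(* The bilinear, degreewise extension of p_l (x) p_m = delta_(l,m) z_l p_l;
   see kron_psump and kron_linear below. *)
Definition kron f g : symser :=
  SymSer (fun l => (zpart l)%:R * coef f l * coef g l).
Notation "f *k g" := (kron f g) (at level 40, left associativity) : ring_scope.

Definition pmon l : symser := SymSer (fun m => (m == l)%:R).

Lemma pmonM l m : pmon l * pmon m = pmon (punion l m).
Proof.
apply: symserP => n; rewrite -[LHS]/(coef (ser_mul _ _) n).
pose d := (psize n + psize l + psize m)%N.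
rewrite (@coef_ser_mul d) ?/d -?addnA ?leq_addr //.
rewrite (bigD1_seq l) ?mem_parts_upto ?parts_upto_uniq //=; last by lia.
rewrite (bigD1_seq m) ?mem_parts_upto ?parts_upto_uniq //=; last by lia.
rewrite !eqxx !mulr1 eq_sym !big1 ?addr0 //.
  move=> a /negPf al; apply: big1 => b _; by rewrite al mul0r mulr0.
by move=> b /negPf->; rewrite !mulr0.
Qed.

Lemma psumpE l : psump l = pmon l.
Proof.
rewrite /psump; case: l => s sP /=; elim: s sP => [|n s IH] sP.
  rewrite big_nil; apply: symserP => l /=; congr (_%:R).
have sP' : is_part s.
  have /andP[sn s0] := sP; rewrite /is_part (path_sorted sn).
  by move: s0; rewrite inE negb_or => /andP[].
have nP : is_part [:: n].
  by have /andP[_] := sP; rewrite /is_part !inE !negb_or => /andP[->].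
rewrite big_cons (IH sP').
have -> : psum n = pmon (Part nP) by apply: symserP.
rewrite pmonM; congr pmon; apply: part_inj; exact: (perm_trans (punionE _ _)).
Qed.

Lemma kron_psump l m :
  psump l *k psump m = ((l == m)%:R * (zpart l)%:R) *: psump l.
Proof.
rewrite !psumpE; apply: symserP => n /=.
have [->|] := eqVneq n l; last by rewrite !mulr0 mul0r.
by rewrite !mulr1 mulrC.
Qed.

Lemma kronC : commutative kron.
Proof. by move=> f g; apply: symserP => l /=; rewrite mulrAC. Qed.

Lemma kron_linear f : linear (kron f).
Proof. by move=> a g h; apply: symserP => l /=; rewrite mulrDr mulrCA. Qed.

(* Coefficientwise sum of a family in which each monomial occurs only finitely
   many times (a coefficient with infinite support is summed to 0). *)
Definition ssum (I : choiceType) (A : set I) (F : I -> symser) : symser :=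
  SymSer (fun l => \sum_(i \in A) coef (F i) l).

(* Meaningful for f without constant term. *)
Definition sexp f : symser :=
  ssum [set: nat] (fun k => (k`!%:R)^-1 *: f ^+ k).

(* (1 - f)^(-1/2), for f without constant term. *)
Definition invsqrt1B f : symser :=
  ssum [set: nat] (fun k => ('C(k.*2, k)%:R / 4%:R ^+ k) *: f ^+ k).

(* The product of the F n, n >= 1, provided that F n - 1 has no terms of degree
   less than n: the factors with n > psize l do not affect the coefficient
   at l. *)
Definition sprod (F : nat -> symser) : symser :=
  SymSer (fun l => coef (\prod_(1 <= n < (psize l).+1) F n) l).

(* [:: u_0; ...; u_n], where u_0 = 1 and
   k u_k = \sum_(1 <= r <= k) c_r p_r u_(k-r). *)
Fixpoint newton (c : nat -> rat) (n : nat) : seq symser :=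
  if n is k.+1 then
    let u := newton c k in
    rcons u (n%:R^-1 *: \sum_(1 <= r < n.+1) c r *: (psum r * u`_(n - r)))
  else [:: 1].

(* Complete and elementary symmetric functions, determined over Q by Newton's
   identities n h_n = \sum_r p_r h_(n-r) and
   n e_n = \sum_r (-1)^(r-1) p_r e_(n-r). *)
Definition hsym (n : nat) : symser := (newton (fun=> 1) n)`_n.
Definition esym (n : nat) : symser := (newton (fun r => (-1) ^+ r.+1) n)`_n.

(* Jacobi-Trudi: s_l = det (h_(l_i - i + j)), with h_k = 0 for k < 0. *)
Definition schur l : symser :=
  \det (\matrix_(i < size l, j < size l)
    if (i <= nth 0 l i + j)%N then hsym (nth 0 l i + j - i)%N else 0).

Definition serH : symser := ssum [set: nat] hsym.
Definition serE : symser := ssum [set: nat] esym.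
Definition serS : symser := ssum [set: part] schur.

Definition serModd : symser :=
  sexp (ssum [set n | odd n]
    (fun n => n%:R^-1 *: (psum n / (1 - psum n)))).

Definition serMeven : symser :=
  sexp (ssum [set n | (0 < n)%N && ~~ odd n]
    (fun n => n%:R^-1 *: (psum n / (1 - psum n)))).

Definition serN : symser :=
  sexp (ssum [set n | (0 < n)%N]
    (fun n => (n.*2)%:R^-1 *: (psum n ^+ 2 / (1 - psum n ^+ 2)))).

Definition serP : symser :=
  sexp (- ssum [set n | (0 < n)%N && ~~ odd n]
    (fun n => n%:R^-1 *: (psum n / (1 + psum n)))).

Definition serG : symser := sprod (fun n => invsqrt1B (psum n ^+ 2)).

(* Main.v *)
(* All series are characterized by differential equations. Let D_n = n d/dp_n;
   a series X with D_n X = g_n X for all n, with given g_n, is determined by its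
   constant term. The derivation D_n satisfies D_n (f (x) g) = D_n f (x) D_n g,
   and multiplication by p_n is its adjoint: p_n f (x) g = p_n (f (x) D_n g).
   If D_n f = (p_n + a_n) f and D_n g = (p_n + b_n) g with constants a_n, b_n,
   these two rules form a linear system for D_n (f (x) g), whose solution is
   Mehler's formula; S, S/H and S/E are of this kind, with a_n = [n odd],
   - [n even] and [n even].

   For S itself, D_n S = (p_n + [n odd]) S is proved from Jacobi-Trudi: in terms
   of the exponents al = la + delta, D_n lowers and p_n raises one exponent by n,
   so the coefficient of a Schur function in (D_n - p_n) S is a signed count of
   addable minus removable rim hooks of length n. Encoding al by the indicator
   b of its set of exponents, this is the sum over x of
   (b(x) - b(x+n)) (-1)^(b(x+1)+...+b(x+n-1)), which telescopes to [n odd]. *)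

Require Import Defs.
From HB Require Import structures.
From mathcomp Require Import all_boot all_order all_algebra.
From mathcomp Require Import fingroup perm.
From mathcomp Require Import boolp classical_sets fsbigop.
From mathcomp Require Import zify ring.

Set Implicit Arguments.
Unset Strict Implicit.
Unset Printing Implicit Defensive.

Import Order.TTheory GRing.Theory Num.Theory.
Local Open Scope ring_scope.

Implicit Types (f g h : symser) (l a b : part) (n m d : nat).

(** The obstacle is the equation for S. With N exponents, multiplication by p_n amounts to raising
    one exponent by n only if 0, ..., n-1 all occur among them: a rim hook may add up to n new rows,
    which must already be present as zero parts. Hence one coefficient is treated at a time, with N
    at least n plus the size of its partition; vectors that miss one of these values then have too
    large a degree to matter. Nor is the sum over partitions stable under shifts of an exponent,
    which disturb the order. It is replaced by a signed sum over all integer vectors: determinants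
    with repeated or negative exponents vanish, a reordering changes sign and determinant by the
    same factor, and a shift is a bijection of the index set. The two sides of the equation for S
    are then compared vector by vector, the sign of a hook being the ratio of two Vandermonde signs.
    On the Kronecker side, equations are kept in the form v_n D_n X = w_n X with v_n invertible, so
    that the linear system is solved by multiplying by 1 - p_n^2 instead of dividing. *)

(** * Partitions and truncation *)

(* Meaningful for n > 0; pone 0 is empty. *)
Definition pone n : part := insubd pempty [:: n].
Definition padd n l := punion (pone n) l.

Lemma poneE n : (0 < n)%N -> parts (pone n) = [:: n].
Proof. by move=> n0; rewrite /pone insubdK // unfold_in /is_part /= inE eq_sym -lt0n. Qed.

Lemma padd_perm n l : (0 < n)%N -> perm_eq (padd n l) (n :: l).
Proof. by move=> n0; rewrite (perm_trans (punionE _ _)) // poneE. Qed.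

Lemma count_padd n m l : (0 < n)%N ->
  count_mem m (padd n l) = ((n == m) + count_mem m l)%N.
Proof. by move=> n0; rewrite (seq.permP (padd_perm l n0)). Qed.

Lemma mem_padd n m l : (0 < n)%N ->
  (m \in parts (padd n l)) = (m == n) || (m \in parts l).
Proof. by move=> n0; rewrite (perm_mem (padd_perm l n0)). Qed.

Lemma psize_padd n l : (0 < n)%N -> psize (padd n l) = (n + psize l)%N.
Proof. by move=> n0; rewrite psizeU /psize poneE //= addn0. Qed.

Lemma padd_inj n a b : (0 < n)%N -> padd n a = padd n b -> a = b.
Proof.
move=> n0 e; apply: part_inj; rewrite -(perm_cons n).
by rewrite (perm_trans _ (padd_perm b n0)) // -e perm_sym padd_perm.
Qed.

Lemma part_gt0 n l : n \in parts l -> (0 < n)%N.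
Proof.
by case: l => s /= /andP[_ s0] ns; rewrite lt0n; apply: contra s0 => /eqP <-.
Qed.

Lemma padd_ex n l : n \in parts l -> exists a, l = padd n a.
Proof.
move=> nl; have n0 := part_gt0 nl.
have P : is_part (rem n l).
  case: l nl => s /= /andP[ss s0] _; apply/andP; split.
    apply: subseq_sorted (rem_subseq n s) ss => y x z xy yz.
    exact: leq_trans yz xy.
  by apply: contra s0; apply: mem_rem.
exists (Part P); apply: part_inj.
by rewrite perm_sym (perm_trans (padd_perm _ n0)) //= perm_sym perm_to_rem.
Qed.

Lemma padd_notin n l : (0 < n)%N -> n \notin parts l -> forall a, l <> padd n a.
Proof. by move=> n0 nl a la; case/negP: nl; rewrite la mem_padd // eqxx. Qed.

Lemma part_ind (P : part -> Prop) : P pempty ->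
  (forall n l, (0 < n)%N -> P l -> P (padd n l)) -> forall l, P l.
Proof.
move=> P0 PS l; move: {2}(size l) (erefl (size l)) => k.
elim: k l => [|k IH] l lk.
  by have -> : l = pempty by apply: part_inj; case: (parts l) lk.
case E: (parts l) => [|n s]; first by rewrite E in lk.
have nl : n \in parts l by rewrite E mem_head.
have n0 := part_gt0 nl.
have [a la] := padd_ex nl; rewrite la; apply: PS => //; apply: IH.
by apply: succn_inj; rewrite -lk la (perm_size (padd_perm a n0)).
Qed.

Lemma psize0 l : (psize l == 0)%N = (l == pempty).
Proof.
apply/idP/eqP => [|-> //]; elim/part_ind: l => // n l n0 _.
by rewrite psize_padd // addn_eq0 => /andP[/eqP n00]; rewrite n00 in n0.
Qed.

Lemma punion_padd n a b : punion (padd n a) b = padd n (punion a b).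
Proof. by rewrite /padd punionA. Qed.

Lemma mem_punion n a b : (n \in parts (punion a b)) = (n \in parts a) || (n \in parts b).
Proof. by rewrite (perm_mem (punionE a b)) mem_cat. Qed.

Lemma count_punion n a b :
  count_mem n (punion a b) = (count_mem n a + count_mem n b)%N.
Proof. by rewrite (seq.permP (punionE a b)) count_cat. Qed.

Lemma coef0 l : coef 0 l = 0. Proof. by []. Qed.
Lemma coefD f g l : coef (f + g) l = coef f l + coef g l. Proof. by []. Qed.
Lemma coefN f l : coef (- f) l = - coef f l. Proof. by []. Qed.
Lemma coefB f g l : coef (f - g) l = coef f l - coef g l. Proof. by []. Qed.
Lemma coefZ (c : rat) f l : coef (c *: f) l = c * coef f l. Proof. by []. Qed.
Lemma coef1 l : coef 1 l = (l == pempty)%:R. Proof. by []. Qed.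
Lemma coef_sum I (r : seq I) (P : pred I) (F : I -> symser) l :
  coef (\sum_(i <- r | P i) F i) l = \sum_(i <- r | P i) coef (F i) l.
Proof. exact: (big_morph (fun f => coef f l) (fun f g => coefD f g l) (coef0 l)). Qed.

Lemma coefM d f g l : (psize l <= d)%N -> coef (f * g) l =
  \sum_(a <- parts_upto d) \sum_(b <- parts_upto d)
     (punion a b == l)%:R * (coef f a * coef g b).
Proof. exact: coef_ser_mul. Qed.

Lemma coefM0 f g : coef (f * g) pempty = coef f pempty * coef g pempty.
Proof.
rewrite (@coefM 0) //.
have -> : parts_upto 0 = [:: pempty].
  apply/perm_small_eq/uniq_perm => //; first exact: parts_upto_uniq.
  by move=> l; rewrite mem_parts_upto leqn0 psize0 inE.
by rewrite !big_seq1 punion0l eqxx mul1r.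
Qed.

Lemma coefX0 f k : coef (f ^+ k) pempty = coef f pempty ^+ k.
Proof. by elim: k => [|k IH]; rewrite ?expr0 // !exprS coefM0 IH. Qed.

(** Up to a given degree, infinite sums and products become finite ones; identities are proved in
    this sense for every [d] and joined by [eqdP]. *)
Definition eqd d f g := forall l, (psize l <= d)%N -> coef f l = coef g l.

Lemma eqd_refl d f : eqd d f f. Proof. by []. Qed.
Lemma eqd_sym d f g : eqd d f g -> eqd d g f.
Proof. by move=> e l ld; rewrite e. Qed.
Lemma eqd_trans d f g h : eqd d f g -> eqd d g h -> eqd d f h.
Proof. by move=> e e' l ld; rewrite e // e'. Qed.
Lemma eqd_le d d' f g : (d' <= d)%N -> eqd d f g -> eqd d' f g.
Proof. by move=> dd e l ld; rewrite e // (leq_trans ld). Qed.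
Lemma eqdP f g : (forall d, eqd d f g) -> f = g.
Proof. by move=> e; apply: symserP => l; apply: (e (psize l)). Qed.
Lemma eqdD d f f' g g' : eqd d f f' -> eqd d g g' -> eqd d (f + g) (f' + g').
Proof. by move=> e e' l ld; rewrite !coefD e // e'. Qed.
Lemma eqdN d f f' : eqd d f f' -> eqd d (- f) (- f').
Proof. by move=> e l ld; rewrite !coefN e. Qed.
Lemma eqdZ d (c : rat) f f' : eqd d f f' -> eqd d (c *: f) (c *: f').
Proof. by move=> e l ld; rewrite !coefZ e. Qed.
Lemma eqd_sum d I (r : seq I) (P : pred I) (F G : I -> symser) :
  (forall i, P i -> eqd d (F i) (G i)) ->
  eqd d (\sum_(i <- r | P i) F i) (\sum_(i <- r | P i) G i).
Proof. by move=> e l ld; rewrite !coef_sum; apply: eq_bigr => i Pi; apply: e. Qed.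
Lemma eqdM d f f' g g' : eqd d f f' -> eqd d g g' -> eqd d (f * g) (f' * g').
Proof.
move=> e e' l ld; rewrite !(coefM _ _ ld) big_seq [RHS]big_seq.
apply: eq_bigr => a; rewrite mem_parts_upto => ad.
rewrite big_seq [RHS]big_seq; apply: eq_bigr => b; rewrite mem_parts_upto => bd.
by rewrite e // e'.
Qed.
Lemma eqd_sum0 d I (r : seq I) (P : pred I) (F : I -> symser) :
  (forall i, P i -> eqd d (F i) 0) -> eqd d (\sum_(i <- r | P i) F i) 0.
Proof. by move=> e l ld; rewrite coef_sum big1 // => i Pi; rewrite e. Qed.
Lemma eqd_prod1 d I (r : seq I) (P : pred I) (F : I -> symser) :
  (forall i, P i -> eqd d (F i) 1) -> eqd d (\prod_(i <- r | P i) F i) 1.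
Proof.
move=> e; apply: (big_ind (fun f => eqd d f 1)) => // f g ef eg.
by rewrite -[X in eqd _ _ X](mulr1 1); apply: eqdM.
Qed.
Lemma eqd0 f g : coef f pempty = coef g pempty -> eqd 0 f g.
Proof. by move=> e l; rewrite leqn0 psize0 => /eqP ->. Qed.

Lemma eqd_trunc d f :
  eqd d f (\sum_(a <- parts_upto d) coef f a *: pmon a).
Proof.
move=> l ld; rewrite coef_sum.
transitivity (\sum_(a <- parts_upto d) (l == a)%:R * coef f a).
  by rewrite sum_parts_upto1 ld mul1r.
by apply: eq_bigr => a _; rewrite mulrC.
Qed.

(** * The derivation n d/dp_n *)

(** [padd n l] contains p_n once more than [l] does; this exponent comes down, times n. The factor n
    also makes [D 0] zero. *)
Definition D n f : symser :=
  SymSer (fun l => (n * (count_mem n l).+1)%:R * coef f (padd n l)).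

Lemma coef_D n f l : coef (D n f) l = (n * (count_mem n l).+1)%:R * coef f (padd n l).
Proof. by []. Qed.

Lemma D_is_linear n : linear (D n).
Proof. by move=> c f g; apply: symserP => l /=; rewrite mulrDr mulrCA. Qed.
HB.instance Definition _ n :=
  GRing.isLinear.Build rat symser symser *:%R (D n) (D_is_linear n).

Lemma DZ n (c : rat) f : D n (c *: f) = c *: D n f.
Proof. exact: linearZ. Qed.

Lemma eqd_Dn n d f g : eqd (n + d) f g -> eqd d (D n f) (D n g).
Proof.
case: (posnP n) => [-> _ l _|n0]; first by rewrite !coef_D mul0n !mul0r.
by move=> e l ld; rewrite !coef_D e // psize_padd // leq_add2l.
Qed.

Lemma D_pmon_padd n a : (0 < n)%N ->
  D n (pmon (padd n a)) = (n * (count_mem n a).+1)%:R *: pmon a.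
Proof.
move=> n0; apply: symserP => l; rewrite coef_D coefZ /=.
case: (eqVneq l a) => [->|la]; first by rewrite eqxx.
case: eqP => [/(padd_inj n0) e|_]; last by rewrite !mulr0.
by rewrite e eqxx in la.
Qed.

Lemma D_pmon_notin n a : (0 < n)%N -> n \notin parts a -> D n (pmon a) = 0.
Proof.
move=> n0 na; apply: symserP => l; rewrite coef_D /=.
case: eqP => [e|_]; last by rewrite mulr0.
by case: (padd_notin n0 na (esym e)).
Qed.

Lemma D_pmonM n a b : (0 < n)%N ->
  D n (pmon a * pmon b) = D n (pmon a) * pmon b + pmon a * D n (pmon b).
Proof.
move=> n0; rewrite pmonM.
have [na|na] := boolP (n \in parts a); last first.
  rewrite (D_pmon_notin n0 na) mul0r add0r.
  have [nb|nb] := boolP (n \in parts b); last first.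
    by rewrite !D_pmon_notin ?mulr0 // mem_punion negb_or na.
  have [b' ->] := padd_ex nb.
  rewrite punionC punion_padd !D_pmon_padd // -scalerAr pmonM [punion a _]punionC.
  by rewrite count_punion (count_memPn na) addn0.
have [a' ->] := padd_ex na.
have [nb|nb] := boolP (n \in parts b); last first.
  rewrite punion_padd !D_pmon_padd // (D_pmon_notin n0 nb) mulr0 addr0.
  by rewrite -scalerAl pmonM count_punion (count_memPn nb) addn0.
have [b' ->] := padd_ex nb.
rewrite punion_padd !D_pmon_padd // -scalerAr -scalerAl !pmonM.
rewrite punion_padd [punion a' _]punionC punion_padd [punion b' _]punionC.
rewrite -scalerDl -natrD; congr (_%:R *: _).
rewrite -[padd n (punion _ _)]/(padd n (punion a' b')) count_padd // count_punion eqxx /=.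
by lia.
Qed.

Lemma D0 f : D 0 f = 0.
Proof. by apply: symserP => l; rewrite coef_D mul0n mul0r. Qed.

(** By bilinearity this reduces to monomials once both factors are truncated. The truncation is at
    degree n + d because [D n] lowers degrees by n. *)
Lemma DM n f g : D n (f * g) = D n f * g + f * D n g.
Proof.
case: (posnP n) => [->|n0]; first by rewrite !D0 mul0r mulr0 addr0.
apply: eqdP => d.
have ef := eqd_trunc (d := n + d) f; have eg := eqd_trunc (d := n + d) g.
apply: (eqd_trans (eqd_Dn (eqdM ef eg))).
apply: eqd_sym; apply: (@eqd_trans d _ _ _ (eqdD
  (eqdM (eqd_Dn ef) (eqd_le (leq_addl n d) eg))
  (eqdM (eqd_le (leq_addl n d) ef) (eqd_Dn eg)))).
rewrite !linear_sum !mulr_suml -big_split linear_sum /=.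
apply: eqd_sum => a _; rewrite !mulr_sumr -big_split linear_sum /=.
apply: eqd_sum => b _; rewrite !linearZ /= -!scalerAl -!scalerAr !linearZ /=.
by rewrite D_pmonM // !scalerDr !scalerA ![coef g b * _]mulrC.
Qed.

Lemma D1 n : D n 1 = 0.
Proof. by apply: (addIr (D n 1)); rewrite add0r -{3}[1](mulr1 1) DM mul1r mulr1. Qed.

Lemma DX n f k : D n (f ^+ k) = k%:R *: (f ^+ k.-1 * D n f).
Proof.
elim: k => [|[|k] IH]; first by rewrite D1 scale0r.
  by rewrite expr1 mul1r scale1r.
rewrite exprS DM IH -[in RHS]natr1 scalerDl scale1r /= -scalerAr mulrA -exprS.
by rewrite addrC [D n f * _]mulrC.
Qed.

Lemma D_inv n f : f \is a GRing.unit -> D n f^-1 = - (D n f * f^-1 ^+ 2).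
Proof.
move=> uf; have := D1 n; rewrite -(mulrV uf) DM => /eqP; rewrite addr_eq0 => /eqP e.
apply: (mulrI uf).
by rewrite -[LHS]opprK -e mulrN expr2 mulrCA (mulVKr uf).
Qed.

(** Induction on the degree: agreement up to degree d carries over to [D n f] and [D n g], hence to
    the coefficients at every [padd n l] of size d + 1, and each nonempty partition has this form.
    The units [v n] allow equations with cleared denominators. *)
Lemma D_unique (v w : nat -> symser) f g :
  (forall n, (0 < n)%N -> v n \is a GRing.unit) ->
  (forall n, (0 < n)%N -> v n * D n f = w n * f) ->
  (forall n, (0 < n)%N -> v n * D n g = w n * g) ->
  coef f pempty = coef g pempty -> f = g.
Proof.
move=> vu ef eg e0; apply: eqdP.
have E n h : (0 < n)%N -> v n * D n h = w n * h -> D n h = (v n)^-1 * w n * h.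
  by move=> n0 e; rewrite -mulrA -e mulKr ?vu.
elim=> [|d IH]; first exact: eqd0.
move=> l; elim/part_ind: l => // n l n0 _; rewrite psize_padd // => ld.
have : coef (D n f) l = coef (D n g) l.
  rewrite (E _ _ n0 (ef _ n0)) (E _ _ n0 (eg _ n0)).
  by apply: (@eqdM d) => //; lia.
rewrite !coef_D => /mulfI; apply.
by rewrite pnatr_eq0 muln_eq0 (gtn_eqF n0).
Qed.

Lemma D_eq0 f : (forall n, (0 < n)%N -> D n f = 0) -> coef f pempty = 0 -> f = 0.
Proof.
move=> e e0; apply: (@D_unique (fun=> 1) (fun=> 0)) => // n n0.
- exact: unitr1.
- by rewrite e // mulr0 mul0r.
- by rewrite linear0 mulr0 mul0r.
Qed.

Lemma psumE n : (0 < n)%N -> psum n = pmon (pone n).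
Proof. by move=> n0; apply: symserP => l /=; rewrite -val_eqE /= poneE. Qed.

Lemma pmon0 : pmon pempty = 1.
Proof. exact: symserP. Qed.

Lemma D_psum n m : (0 < m)%N -> D n (psum m) = (n * (n == m))%:R%:A.
Proof.
move=> m0; case: (posnP n) => [->|n0]; first by rewrite D0 mul0n scale0r.
rewrite psumE // -[pone m]punion0l punionC; case: (eqVneq n m) => [->|nm].
  by rewrite (@D_pmon_padd m pempty) // pmon0.
rewrite muln0 scale0r D_pmon_notin // (@mem_padd m n pempty) // orbF.
by rewrite (negPf nm).
Qed.

Lemma coef_psum0 n : coef (psum n) pempty = 0.
Proof. by []. Qed.

Lemma coef_psumM n f l : (0 < n)%N -> coef (psum n * f) (padd n l) = coef f l.
Proof.
move=> n0; rewrite psumE // (@coefM (n + psize l)) ?psize_padd //.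
rewrite (bigD1_seq (pone n)) ?parts_upto_uniq //=; last first.
  by rewrite mem_parts_upto /psize poneE //= addn0 leq_addr.
rewrite [X in _ + X]big1 ?addr0 => [|a /negPf an]; last first.
  by rewrite big1 // => b _; rewrite an mul0r mulr0.
rewrite eqxx; transitivity (\sum_(b <- parts_upto (n + psize l)) (l == b)%:R * coef f b).
  apply: eq_bigr => b _; rewrite mul1r; congr (_%:R * _); congr nat_of_bool.
  by apply/eqP/eqP => [/(padd_inj n0)|->].
by rewrite sum_parts_upto1 leq_addl mul1r.
Qed.

Lemma coef_psumM_notin n f l : n \notin parts l -> coef (psum n * f) l = 0.
Proof.
case: (posnP n) => [->|n0] nl.
  rewrite (_ : psum 0 = 0) ?mul0r //; apply: symserP => a /=.
  case: eqP => // e; have : 0%N \in parts a by rewrite e mem_head.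
  by move/part_gt0.
rewrite psumE // (@coefM (psize l)) // big1 // => a _; rewrite big1 // => b _ /=.
case: (eqVneq a (pone n)) => [->|_]; last by rewrite mul0r mulr0.
case: eqP => [e|_]; last by rewrite mul0r.
by case: (padd_notin n0 nl (esym e)).
Qed.

(** * Power series in a series without constant term *)

Lemma eqd_ssum (I : choiceType) (A : set I) (F : I -> symser) (r : seq I) d :
  uniq r -> (forall i, i \in r -> A i) ->
  (forall i, A i -> i \notin r -> eqd d (F i) 0) ->
  eqd d (ssum A F) (\sum_(i <- r) F i).
Proof.
move=> ur rA Fr l ld; rewrite /= coef_sum (@fsbigE _ _ _ _ A r) //; last first.
  by move=> i Ai ir; rewrite Fr.
by rewrite big_seq_cond [RHS]big_seq; apply: eq_bigl => i; rewrite andb_idr // => /rA;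
  rewrite inE.
Qed.

(** The derivative of f^(k+1) has the factor f^k, which by induction has no terms of degree at most
    d; integrating gains one degree. *)
Lemma eqd_pow d f k : coef f pempty = 0 -> (d < k)%N -> eqd d (f ^+ k) 0.
Proof.
move=> f0; elim: k d => // k IH [|d] dk.
  by apply: eqd0; rewrite exprS coefM0 f0 mul0r.
move=> l; elim/part_ind: l => [|n l n0 _]; first by rewrite coefX0 f0 exprS mul0r.
rewrite psize_padd // => ld.
have : coef (D n (f ^+ k.+1)) l = 0.
  rewrite DX coefZ [k.+1.-1]/= (eqdM (IH d dk) (@eqd_refl d (D n f))) ?mul0r ?mulr0 //.
  by lia.
rewrite coef_D => /eqP; rewrite mulf_eq0 pnatr_eq0 => /orP[|/eqP //].
by rewrite muln_eq0 (gtn_eqF n0).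
Qed.

(** [sexp] and [invsqrt1B] are both of this form by conversion, so that their differential equations
    become recursions for the coefficients [c]. *)
Definition pcomp (c : nat -> rat) f := ssum [set: nat] (fun k => c k *: f ^+ k).

Lemma eqd_comp c f d M : coef f pempty = 0 -> (d < M)%N ->
  eqd d (pcomp c f) (\sum_(0 <= k < M) c k *: f ^+ k).
Proof.
move=> f0 dM; apply: eqd_ssum => // [|k _]; first exact: iota_uniq.
rewrite mem_index_iota /= -leqNgt => Mk; rewrite -(scaler0 _ (c k)).
by apply: eqdZ; apply: eqd_pow => //; apply: leq_trans dM Mk.
Qed.

Lemma coef_comp0 c f : coef f pempty = 0 -> coef (pcomp c f) pempty = c 0.
Proof.
move=> f0; rewrite (@eqd_comp c f 0 1) // big_nat1 coefZ expr0 coef1 eqxx mulr1 //.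
Qed.

Lemma D_comp n c f : coef f pempty = 0 ->
  D n (pcomp c f) = pcomp (fun k => k.+1%:R * c k.+1) f * D n f.
Proof.
move=> f0; apply: eqdP => d.
(* One term more than on the other side, since [D n] kills the term k = 0. *)
apply: (eqd_trans (eqd_Dn (@eqd_comp c f _ (n + d).+2 f0 (ltnW (ltnSn _))))).
apply: eqd_sym; apply: (eqd_trans (eqdM (@eqd_comp _ f _ (n + d).+1 f0 _)
  (@eqd_refl _ _))); first by lia.
rewrite (big_nat_recl (n + d).+1) // linearD linearZ /= D1 scaler0 add0r linear_sum
  mulr_suml.
apply: eqd_sum => k _; rewrite linearZ /= DX /= scalerA -scalerAl.
by rewrite [c _ * _]mulrC.
Qed.

Lemma compX c f : coef f pempty = 0 ->
  f * pcomp c f = pcomp (fun k => if k is k'.+1 then c k' else 0) f.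
Proof.
move=> f0; apply: eqdP => d.
apply: (eqd_trans (eqdM (@eqd_refl _ _) (@eqd_comp c f d d.+1 f0 (ltnSn _)))).
apply: eqd_sym; apply: (eqd_trans (@eqd_comp _ f _ d.+2 f0 _)); first by lia.
rewrite big_nat_recl // scale0r add0r mulr_sumr.
by apply: eqd_sum => k _; rewrite -scalerAr exprS.
Qed.

Lemma compB c c' f : coef f pempty = 0 ->
  pcomp (fun k => c k - c' k) f = pcomp c f - pcomp c' f.
Proof.
move=> f0; apply: eqdP => d; apply: (eqd_trans (eqd_comp _ f0 (ltnSn d))).
apply: eqd_sym; apply: (eqd_trans (eqdD (eqd_comp c f0 (ltnSn d))
  (eqdN (eqd_comp c' f0 (ltnSn d))))).
by rewrite -sumrB; apply: eqd_sum => k _; rewrite -scalerBl.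
Qed.

Lemma compZ x c f : coef f pempty = 0 -> pcomp (fun k => x * c k) f = x *: pcomp c f.
Proof.
move=> f0; apply: eqdP => d; apply: (eqd_trans (eqd_comp _ f0 (ltnSn d))).
apply: eqd_sym; apply: (eqd_trans (eqdZ x (eqd_comp c f0 (ltnSn d)))).
by rewrite scaler_sumr; apply: eqd_sum => k _; rewrite scalerA.
Qed.

Lemma comp_delta f : coef f pempty = 0 -> pcomp (fun k => (k == 0%N)%:R) f = 1.
Proof.
move=> f0; apply: eqdP => d; apply: (eqd_trans (eqd_comp _ f0 (ltnSn d))).
rewrite big_nat_recl // scale1r -[X in eqd _ _ X]addr0; apply: eqdD => //.
by rewrite big1 // => k _; rewrite scale0r.
Qed.

Lemma unit_1B f : coef f pempty = 0 -> 1 - f \is a GRing.unit.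
Proof.
move=> f0; apply/unitrP; exists (pcomp (fun=> 1) f).
suff e : (1 - f) * pcomp (fun=> 1) f = 1 by rewrite mulrC e.
rewrite mulrBl mul1r (compX _ f0) -(compB _ _ f0).
transitivity (pcomp (fun k => (k == 0%N)%:R) f); last exact: comp_delta.
apply: (congr1 (fun c => pcomp c f)).
by apply: funext => -[|k]; rewrite ?subr0 ?subrr.
Qed.

Lemma unit_1D f : coef f pempty = 0 -> 1 + f \is a GRing.unit.
Proof. by move=> f0; rewrite -[f]opprK unit_1B // coefN f0 oppr0. Qed.

Lemma coef_sexp0 f : coef f pempty = 0 -> coef (sexp f) pempty = 1.
Proof. by move=> f0; rewrite (@coef_comp0 (fun k => k`!%:R^-1)) // invr1. Qed.

Lemma D_sexp n f : coef f pempty = 0 -> D n (sexp f) = D n f * sexp f.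
Proof.
move=> f0; rewrite (@D_comp n (fun k => k`!%:R^-1)) // mulrC; congr (_ * _).
apply: (congr1 (fun c => pcomp c f)); apply: funext => k.
by rewrite factS natrM invfM mulVKf // pnatr_eq0.
Qed.

Lemma central_bin k : (k.+1 * 'C(k.+1.*2, k.+1) = (k.*2.+1).*2 * 'C(k.*2, k))%N.
Proof.
have e : (k.*2 - k)%N = k by lia.
have := bin_fact (leq_addl k k); rewrite addnn e => E.
have := bin_fact (leq_addl k.+1 k.+1); rewrite addnn (_ : k.+1.*2 - k.+1 = k.+1)%N;
  last by lia.
rewrite doubleS !factS -E => /eqP E'.
have p : (0 < (k`! * k`!) * k.+1)%N by rewrite !muln_gt0 fact_gt0.
by apply/eqP; rewrite -(eqn_pmul2r p); move: E'; move: ('C(_, _)) ('C(_, _)) (k`!); nia.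
Qed.

(** The recursion (k + 1) c_(k+1) = (k + 1/2) c_k for c_k = C(2k, k) / 4^k, which is [central_bin],
    is the equation (1 - t) y' = y / 2 of y = (1 - t)^(-1/2). *)
Lemma D_invsqrt n f : coef f pempty = 0 ->
  (1 - f) * D n (invsqrt1B f) = 2^-1 *: (D n f * invsqrt1B f).
Proof.
move=> f0; set c := fun k => 'C(k.*2, k)%:R / 4%:R ^+ k : rat.
rewrite (@D_comp n c) // mulrA mulrBl mul1r (compX _ f0) -(compB _ _ f0).
rewrite mulrC scalerAr; congr (_ * _); rewrite -compZ //.
apply: (congr1 (fun c => pcomp c f)); apply: funext => k.
have cE j : c j = 'C(j.*2, j)%:R / 4%:R ^+ j by [].
have E : k.+1%:R * c k.+1 = (k%:R + 2^-1) * c k.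
  rewrite cE mulrA -natrM central_bin natrM exprS invfM cE.
  rewrite -muln2 natrM -natr1 -muln2 natrM.
  move: (4 ^+ k)^-1 ('C(_, _)%:R) (k%:R) => x y z.
  by field.
rewrite -[X in 2^-1 * X]/(c k); case: k E => [|k] E; first by rewrite E subr0 add0r.
by rewrite E -natr1; ring.
Qed.

(** * Newton's recursion *)

Definition homog k f := forall l, psize l != k -> coef f l = 0.

Lemma homogM i j f g : homog i f -> homog j g -> homog (i + j) (f * g).
Proof.
move=> hf hg l lij; rewrite (@coefM (psize l)) // big1 // => a _.
rewrite big1 // => b _; case: eqP => [e|_]; last by rewrite mul0r.
have [ai|ai] := eqVneq (psize a) i; last by rewrite hf // mul0r mulr0.
rewrite [coef g b]hg ?mulr0 //; apply: contra lij => /eqP bj.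
by rewrite -e psizeU ai bj.
Qed.

Lemma homogZ k c f : homog k f -> homog k (c *: f).
Proof. by move=> hf l lk; rewrite coefZ hf // mulr0. Qed.

Lemma homog_prod I (r : seq I) (k : I -> nat) (F : I -> symser) :
  (forall i, homog (k i) (F i)) ->
  homog (\sum_(i <- r) k i) (\prod_(i <- r) F i).
Proof.
move=> hF; elim: r => [|i r IH]; last by rewrite !big_cons; apply: homogM.
by rewrite !big_nil => l; rewrite psize0 coef1 => /negPf ->.
Qed.

Lemma homog_psum n : homog n (psum n).
Proof.
move=> l ln /=; case: eqP => // e; move: ln.
by rewrite /psize e /= addn0 eqxx.
Qed.

Lemma homog_eqd k d f : homog k f -> (d < k)%N -> eqd d f 0.
Proof. by move=> hf dk l ld; rewrite hf //; lia. Qed.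

Definition newton_term c k := (newton c k)`_k.

Lemma size_newton c k : size (newton c k) = k.+1.
Proof. by elim: k => //= k IH; rewrite size_rcons IH. Qed.

Lemma nth_newton c k j : (j <= k)%N -> (newton c k)`_j = newton_term c j.
Proof.
elim: k => [|k IH]; first by rewrite leqn0 => /eqP ->.
rewrite leq_eqVlt => /orP[/eqP -> //|jk].
by rewrite [newton c k.+1]/= nth_rcons size_newton jk IH.
Qed.

Lemma newton_term0 c : newton_term c 0 = 1. Proof. by []. Qed.

Lemma newton_term_rec c k : k%:R *: newton_term c k =
  \sum_(1 <= r < k.+1) c r *: (psum r * newton_term c (k - r)).
Proof.
case: k => [|k]; first by rewrite scale0r big_geq.
rewrite {1}/newton_term [newton c k.+1]/= nth_rcons size_newton ltnn eqxx scalerA.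
rewrite mulfV ?pnatr_eq0 // scale1r big_nat [RHS]big_nat; apply: eq_bigr => r rk.
by rewrite nth_newton //; lia.
Qed.

Lemma homog_newton_term c k : homog k (newton_term c k).
Proof.
have [j] := ubnP k; elim: j k => // j IH [|k] kj.
  by move=> l; rewrite newton_term0 coef1 psize0 => /negPf ->.
move=> l lk; suff : coef (k.+1%:R *: newton_term c k.+1) l = 0.
  by rewrite coefZ => /eqP; rewrite mulf_eq0 pnatr_eq0 /= => /eqP.
rewrite newton_term_rec coef_sum big_nat big1 // => r rk; apply: homogZ lk.
rewrite (_ : k.+1 = (r + (k.+1 - r))%N); last by lia.
rewrite [X in newton_term c X](_ : _ = (k.+1 - r)%N); last by lia.
by apply: homogM; [exact: homog_psum | apply: IH; lia].
Qed.

(** Differentiate the recursion for k u_k. The summand r = m yields m c_m u_(k-m) from D_m p_m = m;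
    by induction the rest is c_m times the recursion for (k - m) u_(k-m). Together this is k c_m
    u_(k-m). *)
Lemma D_newton_term m c k : (0 < m)%N ->
  D m (newton_term c k) = if (m <= k)%N then c m *: newton_term c (k - m) else 0.
Proof.
move=> m0; have [j] := ubnP k; elim: j k => // j IH [|k] kj.
  by rewrite newton_term0 D1 leqNgt m0.
apply: (@scalerI _ _ k.+1%:R); first by rewrite pnatr_eq0.
rewrite -linearZ newton_term_rec linear_sum /= big_nat.
transitivity (\sum_(1 <= r < k.+2) ((m%:R * (m == r)%:R * c m) *: newton_term c (k.+1 - m)
   + (m + r <= k.+1)%N%:R *: (c m *: (c r *: (psum r * newton_term c (k.+1 - m - r)))))).
  rewrite [RHS]big_nat; apply: eq_bigr => r rk; rewrite linearZ /= DM D_psum; last by lia.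
  rewrite IH; last by lia.
  rewrite scalerDr; congr (_ + _).
    rewrite scalerAl scalerA -scalerAl mul1r natrM mulrC.
    by case: eqP => [->//|]; rewrite !mulr0 !mul0r !scale0r.
  rewrite (_ : (m <= k.+1 - r)%N = (m + r <= k.+1)%N); last by lia.
  case: ifP => _; last by rewrite mulr0 scaler0 scale0r.
  by rewrite scale1r -scalerAr !scalerA [c m * _]mulrC subnAC.
rewrite big_split /= -scaler_suml -mulr_suml -mulr_sumr.
have [mk|mk] := leqP m k.+1; last first.
  rewrite scaler0 [X in _ * X * _](_ : _ = 0); last first.
    by rewrite big_nat big1 // => r rk; case: eqP => //; lia.
  rewrite mulr0 mul0r scale0r add0r big_nat big1 // => r rk.
  by rewrite (_ : (_ <= _)%N = false) ?scale0r //; lia.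
rewrite [X in _ * X * _](_ : _ = 1); last first.
  rewrite (bigD1_seq m) ?iota_uniq ?mem_index_iota //=; last by lia.
  by rewrite eqxx big1 ?addr0 // => r /negPf; rewrite eq_sym => ->.
rewrite mulr1.
have -> : \sum_(1 <= r < k.+2) (m + r <= k.+1)%N%:R *: (c m *: (c r *: (psum r *
  newton_term c (k.+1 - m - r))))
   = c m *: ((k.+1 - m)%N%:R *: newton_term c (k.+1 - m)).
  rewrite newton_term_rec (@big_cat_nat _ _ _ (k.+1 - m).+1) /=; [|lia|lia].
  rewrite [X in _ + X]big_nat [X in _ + X]big1 ?addr0 => [|r rk]; last first.
    by rewrite (_ : (_ <= _)%N = false) ?scale0r //; lia.
  rewrite scaler_sumr big_nat [RHS]big_nat; apply: eq_bigr => r rk.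
  by rewrite (_ : (_ <= _)%N) ?scale1r //; lia.
rewrite scalerA -scalerDl scalerA; congr (_ *: _).
by rewrite natrB //; ring.
Qed.

(** [serH] and [serE] are, by conversion, the cases c_r = 1 and c_r = (-1)^(r+1). *)
Definition newton_ser c := ssum [set: nat] (newton_term c).

Lemma eqd_newton_ser c d M : (d < M)%N ->
  eqd d (newton_ser c) (\sum_(0 <= k < M) newton_term c k).
Proof.
move=> dM; apply: eqd_ssum => // [|k _]; first exact: iota_uniq.
rewrite mem_index_iota /= -leqNgt => Mk.
by apply: homog_eqd (@homog_newton_term c k) _; lia.
Qed.

Lemma coef_newton_ser0 c : coef (newton_ser c) pempty = 1.
Proof. by rewrite (@eqd_newton_ser c 0 1) // big_nat1 newton_term0 coef1. Qed.

Lemma D_newton_ser m c : (0 < m)%N -> D m (newton_ser c) = c m *: newton_ser c.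
Proof.
move=> m0; apply: eqdP => d.
apply: (eqd_trans (eqd_Dn (@eqd_newton_ser c _ (m + d.+1) _))); first by lia.
apply: eqd_sym; apply: (eqd_trans (eqdZ (c m) (@eqd_newton_ser c d d.+1 _))) => //.
rewrite scaler_sumr (linear_sum (D m)) [X in eqd _ _ X](@big_cat_nat _ _ _ m) ?leq_addr
  //=.
rewrite [X in X + _]big_nat [X in X + _]big1 ?add0r => [|r rk]; last first.
  by rewrite D_newton_term // leqNgt; case/andP: rk => _ ->.
rewrite (big_addn 0 _ m) addKn.
by apply: eqd_sum => r _; rewrite D_newton_term // leq_addl addnK.
Qed.

Lemma D_ssum n (I : choiceType) (A : set I) (F : I -> symser) (r : seq I) :
  (0 < n)%N ->
  uniq r -> (forall i, i \in r -> A i) ->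
  (forall i, A i -> i \notin r -> D n (F i) = 0) ->
  D n (ssum A F) = \sum_(i <- r) D n (F i).
Proof.
move=> n0 ur rA Fr; apply: symserP => l; rewrite coef_sum coef_D /=.
rewrite (@fsbigE _ _ _ _ A r) //; last first.
  move=> i Ai ir; have := congr1 (fun f => coef f l) (Fr i Ai ir).
  rewrite coef_D coef0 => /eqP; rewrite mulf_eq0 pnatr_eq0 muln_eq0 (gtn_eqF n0).
  by move/eqP.
rewrite mulr_sumr big_seq_cond [RHS]big_seq; apply: eq_bigl => i.
by rewrite andb_idr // => /rA; rewrite inE.
Qed.

Lemma coef_ssum0 (I : choiceType) (A : set I) (F : I -> symser) l :
  (forall i, A i -> coef (F i) l = 0) -> coef (ssum A F) l = 0.
Proof. by move=> e; rewrite /= fsbig1. Qed.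

Lemma newton_ser_exp c :
  newton_ser c = sexp (ssum [set n | (0 < n)%N] (fun n => (c n / n%:R) *: psum n)).
Proof.
set f := ssum _ _.
have f0 : coef f pempty = 0.
  by apply: coef_ssum0 => n _; rewrite coefZ coef_psum0 mulr0.
apply: (@D_unique (fun=> 1) (fun n => (c n)%:A)).
- by move=> n _; exact: unitr1.
- by move=> n n0; rewrite [LHS]mul1r (D_newton_ser _ n0) mulr_algl.
- move=> n n0; rewrite mul1r D_sexp //; congr (_ * _).
  rewrite (@D_ssum n _ _ _ [:: n]) // => [|i|i /= i0].
  + rewrite big_seq1 linearZ /= D_psum // eqxx muln1 scalerA.
    by rewrite divfK // pnatr_eq0 -lt0n.
  + by rewrite inE => /eqP ->.
  + rewrite inE => ni; rewrite linearZ /= D_psum // eq_sym (negPf ni) muln0.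
    by rewrite !scale0r scaler0.
- by rewrite coef_newton_ser0 coef_sexp0.
Qed.

Lemma unit_newton_ser c : newton_ser c \is a GRing.unit.
Proof.
rewrite -[newton_ser c](subrKC 1) -[newton_ser c - 1]opprK; apply: unit_1B.
by rewrite coefN coefB coef_newton_ser0 coef1 eqxx subrr oppr0.
Qed.

(** * The Kronecker product *)
(** A range that does not depend on [l] lets the values of z at two partitions be compared factor by
    factor. Indices that are not parts, 0 among them, contribute i^0 0! = 1. *)
Lemma zpartE l M : (forall i, i \in parts l -> (i < M)%N) ->
  zpart l = (\prod_(0 <= i < M) (i ^ count_mem i l * (count_mem i l)`!))%N.
Proof.
move=> lM; rewrite /zpart [RHS](bigID (fun i => i \in parts l)) /=.
rewrite [X in _ = (_ * X)%N]big1 ?muln1 => [|i /count_memPn -> //].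
rewrite -[RHS]big_filter; apply: perm_big; apply: uniq_perm.
- exact: undup_uniq.
- by rewrite filter_uniq ?iota_uniq.
- move=> i; rewrite mem_undup mem_filter mem_index_iota /= andb_idr //.
  exact: lM.
Qed.

Lemma zpart_padd n l : (0 < n)%N ->
  zpart (padd n l) = (n * (count_mem n l).+1 * zpart l)%N.
Proof.
move=> n0; pose M := (n + psize l).+1.
have nM : (n < M)%N by rewrite ltnS leq_addr.
have lM i : i \in parts l -> (i < M)%N.
  rewrite /M /psize => il; rewrite ltnS (leq_trans _ (leq_addl _ _)) //.
  by have := perm_sumn (perm_to_rem il); rewrite /= => ->; rewrite leq_addr.
rewrite (@zpartE _ M) => [|i]; last first.
  by rewrite mem_padd // => /orP[/eqP ->|/lM].
rewrite (zpartE lM) (bigD1_seq n) ?iota_uniq ?mem_index_iota //.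
rewrite [in RHS](bigD1_seq n) ?iota_uniq ?mem_index_iota //.
rewrite mulnA count_padd // eqxx add1n expnS factS; congr (_ * _)%N; first by lia.
by apply: eq_bigr => i /negPf; rewrite count_padd // eq_sym => ->.
Qed.

(* The factor n (m_n(l) + 1) of D n is the quotient of the two values of z. *)
Lemma D_kron n f g : (0 < n)%N -> D n (f *k g) = D n f *k D n g.
Proof.
move=> n0; apply: symserP => l; rewrite coef_D /= zpart_padd //.
by rewrite [in LHS]natrM; ring.
Qed.

Lemma psum_kron n f g : (0 < n)%N -> (psum n * f) *k g = psum n * (f *k D n g).
Proof.
move=> n0; apply: symserP => l.
rewrite -[LHS]/((zpart l)%:R * coef (psum n * f) l * coef g l).
have [nl|nl] := boolP (n \in parts l); last by rewrite !coef_psumM_notin // mulr0 mul0r.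
have [a ->] := padd_ex nl.
rewrite !coef_psumM // -[RHS]/((zpart a)%:R * coef f a * coef (D n g) a) coef_D.
by rewrite zpart_padd // [in LHS]natrM; ring.
Qed.

Lemma kron_psum n f g : (0 < n)%N -> f *k (psum n * g) = psum n * (D n f *k g).
Proof. by move=> n0; rewrite kronC psum_kron // kronC. Qed.

Lemma kronDr f g h : f *k (g + h) = f *k g + f *k h.
Proof. by apply: symserP => l; rewrite /= mulrDr. Qed.
Lemma kronZr (c : rat) f g : f *k (c *: g) = c *: (f *k g).
Proof. by apply: symserP => l; rewrite /= mulrCA. Qed.
Lemma kronDl f g h : (g + h) *k f = g *k f + h *k f.
Proof. by rewrite ![_ *k f]kronC kronDr. Qed.
Lemma kronZl (c : rat) f g : (c *: g) *k f = c *: (g *k f).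
Proof. by rewrite ![_ *k f]kronC kronZr. Qed.
Lemma coef_kron0 f g : coef (f *k g) pempty = coef f pempty * coef g pempty.
Proof. by rewrite /= /zpart big_nil mul1r. Qed.

(** * Gaussian series and Mehler's formula *)

(* The constant term and the equations of exp (\sum_n (p_n^2 / (2n) + a_n p_n / n)). *)
Definition gauss (a : nat -> rat) f :=
  coef f pempty = 1 /\ forall n, (0 < n)%N -> D n f = psum n * f + a n *: f.

Lemma gauss_unique (a : nat -> rat) f g : gauss a f -> gauss a g -> f = g.
Proof.
move=> [f0 fD] [g0 gD].
apply: (@D_unique (fun=> 1) (fun n => psum n + (a n)%:A)); rewrite ?f0 ?g0 //.
- by move=> n _; exact: unitr1.
- by move=> n n0; rewrite mul1r fD // mulrDl -scalerAl mul1r.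
- by move=> n n0; rewrite mul1r gD // mulrDl -scalerAl mul1r.
Qed.

(** The inverse of [newton_ser c] is an eigenvector of [D n] with eigenvalue [- c n]. This produces
    S/H and S/E from S. *)
Lemma gauss_newton_serV (a c : nat -> rat) f : gauss a f ->
  gauss (fun n => a n - c n) (f * (newton_ser c)^-1).
Proof.
move=> [f0 fD]; have u := unit_newton_ser c; split.
  have := congr1 (fun h => coef h pempty) (mulrV u).
  by rewrite !coefM0 coef_newton_ser0 f0 coef1 eqxx.
move=> n n0; rewrite DM fD // D_inv // D_newton_ser // mulrDl -mulrA -addrA;
  congr (_ + _).
rewrite -!scalerAl mulrN -scalerAr expr2 (mulVKr u) -?mulrA.
by rewrite scalerBl addrC -scaleNr scalerAr.
Qed.

Lemma newton_ser_kron c c' : newton_ser c *k newton_ser c' = newton_ser (fun n =>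
  c n * c' n).
Proof.
apply: (@D_unique (fun=> 1) (fun n => (c n * c' n)%:A)).
- by move=> n _; exact: unitr1.
- move=> n n0; rewrite mul1r D_kron // !D_newton_ser // kronZr kronZl scalerA mulrC.
  by rewrite -scalerAl mul1r.
- by move=> n n0; rewrite mul1r D_newton_ser // -scalerAl mul1r.
- by rewrite coef_kron0 !coef_newton_ser0 mulr1.
Qed.

(** [D n] of the left factor yields one [c n], and moving p_n out of the right factor yields
    another. The coefficient of p_n is therefore c_n^2 = 1, while the constant a_n is multiplied by
    c_n once. *)
Lemma newton_ser_kron_gauss (c a : nat -> rat) f : (forall n, (0 < n)%N ->
  c n ^+ 2 = 1) -> gauss a f ->
  gauss (fun n => c n * a n) (newton_ser c *k f).
Proof.
move=> c2 [f0 fD]; split=> [|n n0]; first by rewrite coef_kron0 f0 coef_newton_ser0 mulr1.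
rewrite D_kron // fD // D_newton_ser // kronZl kronDr kronZr kron_psum // D_newton_ser //.
by rewrite kronZl -scalerAr scalerDr !scalerA -expr2 c2 // scale1r.
Qed.

(** The unknowns U, V, W are X with p_n multiplied into the left factor, the right factor, or both.
    U and V are coupled by the adjunction and have denominator 1 - p_n^2; W has the same denominator
    over an expression in V, whence the square in the statement. *)
Lemma gauss_kron (a b : nat -> rat) f g n : (0 < n)%N -> gauss a f -> gauss b g ->
  (1 - psum n ^+ 2) ^+ 2 * D n (f *k g) =
  (n%:R%:A * psum n * (1 - psum n ^+ 2) + (a n * b n)%:A * (1 + psum n ^+ 2) +
   (a n ^+ 2 + b n ^+ 2)%:A * psum n) * (f *k g).
Proof.
move=> n0 [_ fD] [_ gD].
pose X := f *k g; pose U := (psum n * f) *k g; pose V := f *k (psum n * g).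
pose W := (psum n * f) *k (psum n * g); pose p := psum n.
pose A := (a n)%:A : symser; pose B := (b n)%:A : symser; pose N := n%:R%:A : symser.
have EU : U = p * (V + B * X).
  by rewrite /U psum_kron // gD // kronDr kronZr /B -scalerAl mul1r.
have EV : V = p * (U + A * X).
  by rewrite /V kron_psum // fD // kronDl kronZl /A -scalerAl mul1r.
(* Moving the left p_n out differentiates p_n g; the term N X comes from D_n p_n = n. *)
have EW : W = p * (N * X + (p * (W + A * V) + B * V)).
  rewrite [LHS]psum_kron // DM D_psum // eqxx muln1 -scalerAl mul1r gD //.
  rewrite mulrDr -scalerAr !kronDr !kronZr (kron_psum _ (psum n * g)) // fD //.
  by rewrite kronDl kronZl /A /B /N -!scalerAl !mul1r.
have ED : D n X = W + B * U + A * V + A * B * X.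
  rewrite /X D_kron // fD // gD // !(kronDl, kronDr, kronZl, kronZr) /A /B.
  by rewrite -mulrA !mulr_algl scalerDr !addrA.
rewrite -/X -/p ED.
have -> : (a n * b n)%:A = A * B by rewrite /A /B -scalerAl mul1r scalerA.
have -> : (a n ^+ 2 + b n ^+ 2)%:A = A ^+ 2 + B ^+ 2.
  by rewrite scalerDl /A /B !exprZn !expr1n.
rewrite -/N.
move: EU EV EW; clearbody X U V W A B N p => EU EV EW.
have EU' : (1 - p ^+ 2) * U = (A * p ^+ 2 + B * p) * X.
  rewrite mulrBl mul1r {1}EU {1}EV; ring.
have EV' : (1 - p ^+ 2) * V = (B * p ^+ 2 + A * p) * X.
  rewrite mulrBl mul1r {1}EV {1}EU; ring.
have EW' : (1 - p ^+ 2) * W = N * p * X + (A * p ^+ 2 + B * p) * V.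
  rewrite mulrBl mul1r {1}EW; ring.
set u := 1 - p ^+ 2 in EU' EV' EW' *.
transitivity (u * (u * W) + u * (B * (u * U) + A * (u * V) + A * B * (u * X)));
  first by ring.
rewrite EW' mulrDr.
have -> : u * ((A * p ^+ 2 + B * p) * V) = (A * p ^+ 2 + B * p) * (u * V) by ring.
rewrite EU' EV' /u; ring.
Qed.

Lemma unit_1Bpp n : 1 - psum n ^+ 2 \is a GRing.unit.
Proof. by rewrite unit_1B // coefX0 coef_psum0 expr0n. Qed.
Lemma unit_1Bp n : 1 - psum n \is a GRing.unit.
Proof. by rewrite unit_1B. Qed.
Lemma unit_1Dp n : 1 + psum n \is a GRing.unit.
Proof. by rewrite unit_1D. Qed.

Lemma eqd_sprod F d M : (forall n, (0 < n)%N -> eqd n.-1 (F n) 1) -> (d < M)%N ->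
  eqd d (sprod F) (\prod_(1 <= n < M) F n).
Proof.
move=> F1 dM l ld; rewrite /= [in RHS](@big_cat_nat _ _ _ (psize l).+1) //=; last by lia.
rewrite -[\prod_(1 <= n < _) _ in LHS]mulr1.
apply: (@eqdM (psize l)) => //.
apply: eqd_sym; rewrite big_nat.
apply: eqd_prod1 => i /andP[li iM]; apply: (@eqd_le i.-1); last by apply: F1; lia.
by lia.
Qed.

Lemma eqd_invsqrt d f : eqd d f 0 -> eqd d (invsqrt1B f) 1.
Proof.
move=> fd; have f0 : coef f pempty = 0 by rewrite fd // coef0.
pose c := fun k => 'C(k.*2, k)%:R / 4%:R ^+ k : rat.
apply: (eqd_trans (@eqd_comp c f d d.+1 f0 (ltnSn d))).
rewrite big_nat_recl // expr0 /c bin0 expr0 divr1 scale1r -[X in eqd _ _ X]addr0.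
apply: eqdD => //; apply: eqd_sum0 => k _;
  rewrite -(scaler0 _ ('C(k.+1.*2, k.+1)%:R / 4 ^+ k.+1)).
apply: eqdZ; rewrite exprS -(mul0r (f ^+ k)); exact: eqdM.
Qed.

Lemma eqd_G d M : (d < M)%N ->
  eqd d serG (\prod_(1 <= n < M) invsqrt1B (psum n ^+ 2)).
Proof.
apply: eqd_sprod => n n0; apply: eqd_invsqrt.
by apply: homog_eqd (homogM (@homog_psum n) (@homog_psum n)) _; lia.
Qed.

Lemma coef_G0 : coef serG pempty = 1.
Proof. by rewrite (@eqd_G 0 1) // big_geq // coef1. Qed.

Lemma D_prod n (u w : symser) (F : nat -> symser) (s : seq nat) :
  (forall i, i \in s -> u * D n (F i) = (i == n)%:R * w * F i) ->
  u * D n (\prod_(i <- s) F i) = (count_mem n s)%:R * w * \prod_(i <- s) F i.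
Proof.
elim: s => [|i s IH] H; first by rewrite big_nil D1 mulr0 !mul0r.
rewrite big_cons DM mulrDr mulrA H ?mem_head // mulrCA IH => [|j js]; last first.
  by apply: H; rewrite inE js orbT.
by rewrite /= natrD; ring.
Qed.

Lemma D_G n : (0 < n)%N ->
  (1 - psum n ^+ 2) * D n serG = n%:R * psum n * serG.
Proof.
move=> n0; apply: eqdP => d.
apply: (eqd_trans (eqdM (@eqd_refl _ _) (eqd_Dn (@eqd_G _ (n + d).+1 _)))) => //.
apply: eqd_sym; apply: (eqd_trans (eqdM (@eqd_refl _ _) (@eqd_G d (n + d).+1 _))).
  by lia.
rewrite (@D_prod n _ (n%:R * psum n)).
  rewrite count_uniq_mem ?iota_uniq // mem_index_iota n0 ltnS leq_addr mul1r.
  exact: eqd_refl.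
move=> i; rewrite mem_index_iota => /andP[i0 _]; have [->|ni] := eqVneq i n.
  rewrite D_invsqrt ?coefX0 ?coef_psum0 ?expr0n // DX expr1 D_psum // eqxx muln1.
  rewrite mul1r -!scalerAl -!scalerAr !scalerA -scalerAl mulr1 scaler_nat.
  by rewrite mulVf // scale1r -mulrA mulr_natl.
rewrite -{1}(mulr1 (1 - _)) !mul0r D_comp ?coefX0 ?coef_psum0 ?expr0n // DX expr1.
by rewrite D_psum // eq_sym (negPf ni) muln0 scale0r ?mulr0 ?scaler0 ?mulr0.
Qed.

(** [serG] accounts for the summand n p_n (1 - p_n^2) of [gauss_kron]; the exponent F has to supply
    the remaining two. *)
Lemma mehler (a b : nat -> rat) f g (F : symser) : gauss a f -> gauss b g ->
  coef F pempty = 0 ->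
  (forall n, (0 < n)%N -> (1 - psum n ^+ 2) ^+ 2 * D n F =
     (a n * b n)%:A * (1 + psum n ^+ 2) + (a n ^+ 2 + b n ^+ 2)%:A * psum n) ->
  f *k g = serG * sexp F.
Proof.
move=> fa gb F0 FD.
apply: (@D_unique (fun n => (1 - psum n ^+ 2) ^+ 2) (fun n =>
  n%:R%:A * psum n * (1 - psum n ^+ 2) + (a n * b n)%:A * (1 + psum n ^+ 2) +
   (a n ^+ 2 + b n ^+ 2)%:A * psum n)).
- by move=> n n0; rewrite unitrX ?unit_1Bpp.
- by move=> n n0; apply: gauss_kron.
- move=> n n0; rewrite DM D_sexp // mulrDr.
  rewrite {1}expr2 -mulrA mulrA [_ * D n serG * _]mulrC.
  rewrite !mulrA -[_ * D n serG]mulrC.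
  have := FD _ n0; have := D_G n0.
  move: (D n serG) (D n F) => x y e1 e2.
  rewrite scaler_nat.
  transitivity ((1 - psum n ^+ 2) * sexp F * ((1 - psum n ^+ 2) * x) +
    serG * sexp F * ((1 - psum n ^+ 2) ^+ 2 * y)); first by ring.
  rewrite e1 e2; ring.
- case: fa gb => [f0 _] [g0 _].
  by rewrite coef_kron0 coefM0 f0 g0 coef_G0 coef_sexp0.
Qed.

(** * Jacobi-Trudi determinants *)

Section Tuples.

(** With integer indices and zero at negative ones, [D m] is the shift of the index by m without
    boundary cases. *)
Definition hz (k : int) : symser := if k is Posz j then hsym j else 0.

Lemma hsymE k : hsym k = newton_term (fun=> 1) k. Proof. by []. Qed.

Lemma hz_neg (k : int) : (k < 0)%R -> hz k = 0.
Proof. by case: k. Qed.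

Lemma homog_hz (k : int) : homog `|k|%N (hz k).
Proof. by case: k => // k; exact: homog_newton_term. Qed.

Lemma D_hz m (k : int) : (0 < m)%N -> D m (hz k) = hz (k - m%:Z).
Proof.
move=> m0; case: k => k /=; last first.
  by rewrite linear0 hz_neg //; lia.
rewrite hsymE D_newton_term //; case: leqP => km; first by rewrite subzn // scale1r.
by rewrite hz_neg //; lia.
Qed.

Lemma D_sign n (b : bool) f : D n ((-1) ^+ b * f) = (-1) ^+ b * D n f.
Proof. by rewrite !mulr_sign; case: b => //; rewrite linearN. Qed.

Lemma D_prod_sum n (I : eqType) (r : seq I) (F : I -> symser) : uniq r ->
  D n (\prod_(k <- r) F k) =
  \sum_(i <- r) \prod_(k <- r) (if k == i then D n (F k) else F k).
Proof.
elim: r => [|i r IH] /=; first by rewrite !big_nil D1.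
move=> /andP[ir ur]; rewrite !big_cons DM IH // eqxx; congr (_ + _).
  congr (_ * _); rewrite big_seq [RHS]big_seq; apply: eq_bigr => k kr.
  by case: eqP => // e; rewrite -e kr in ir.
rewrite mulr_sumr [LHS]big_seq [RHS]big_seq; apply: eq_bigr => k kr.
by rewrite big_cons; case: eqP => // e; rewrite e kr in ir.
Qed.

Variable N : nat.
Local Notation A := {ffun 'I_N -> int}.
Implicit Types (al be : A) (s : 'S_N).

Definition sh (i : 'I_N) (x : int) al : A := [ffun k =>
  if k == i then al k + x else al k].

Lemma shE i x al k : sh i x al k = if k == i then al k + x else al k.
Proof. by rewrite ffunE. Qed.

Lemma shC i j x y al : sh i x (sh j y al) = sh j y (sh i x al).
Proof. by apply/ffunP => k; rewrite !shE; do 2!case: ifP => _ //; lia. Qed.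

Lemma shD i x y al : sh i x (sh i y al) = sh i (x + y) al.
Proof.
apply/ffunP => k; rewrite !shE.
by case: (eqVneq k i) => [->|//]; rewrite -addrA [y + x]addrC.
Qed.

Lemma sh0 i al : sh i 0 al = al.
Proof. by apply/ffunP => k; rewrite !shE addr0 if_same. Qed.

Lemma sum_sh i x al : \sum_k sh i x al k = \sum_k al k + x.
Proof.
rewrite (bigD1 i) //= [in RHS](bigD1 i) //= shE eqxx.
rewrite [X in _ + X = _](eq_bigr al); first by rewrite addrAC.
by move=> k /negPf ki; rewrite shE ki.
Qed.

(* The determinant of Jacobi and Trudi for the exponents al = la + delta. *)
Definition sdet al : symser :=
  \det (\matrix_(i < N, j < N) hz (al i - (rev_ord j : nat)%:Z)).

Lemma sdetE al : sdet al = \sum_(s : 'S_N) (-1) ^+ s * \prod_i hz (al i - (rev_ord (s i)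
  : nat)%:Z).
Proof.
apply: eq_bigr => s _; congr (_ * _); apply: eq_bigr => i _.
by rewrite mxE.
Qed.

(** In each term of the determinant, differentiating the factor from row i lowers its index by m
    whatever its column, which is the effect of lowering [al i]. *)
Lemma D_sdet m al : (0 < m)%N -> D m (sdet al) = \sum_i sdet (sh i (- m%:Z) al).
Proof.
move=> m0; rewrite sdetE linear_sum /=.
under [RHS]eq_bigr do rewrite sdetE.
rewrite exchange_big; apply: eq_bigr => s _.
rewrite D_sign -mulr_sumr; congr (_ * _).
rewrite D_prod_sum ?index_enum_uniq //; apply: eq_bigr => i _.
apply: eq_bigr => k _; rewrite shE; case: ifP => // _.
by rewrite D_hz //; congr hz; rewrite addrAC.
Qed.

Lemma sdet_dup al i j : i != j -> al i = al j -> sdet al = 0.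
Proof.
move=> ij e; apply: (determinant_alternate ij) => k.
by rewrite !mxE e.
Qed.

Lemma sdet_neg al i : al i < 0 -> sdet al = 0.
Proof.
move=> ai; rewrite sdetE big1 // => s _.
by rewrite (bigD1 i) //= hz_neg ?mul0r ?mulr0 //; lia.
Qed.

Lemma sdet_swap al be i j : i != j -> be i = al j -> be j = al i ->
  (forall k, k != i -> k != j -> be k = al k) -> sdet be = - sdet al.
Proof.
move=> ij bi bj bk; rewrite /sdet.
have -> : (\matrix_(i < N, j < N) hz (be i - (rev_ord j : nat)%:Z)) =
  row_perm (tperm i j) (\matrix_(i < N, j < N) hz (al i - (rev_ord j : nat)%:Z)).
  apply/matrixP => k c; rewrite !mxE; case: tpermP => [->|->|/eqP ki /eqP kj].
  - by rewrite bi.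
  - by rewrite bj.
  - by rewrite bk.
by rewrite row_permE det_mulmx det_perm odd_tperm ij mulN1r.
Qed.

Lemma sdet_perm al s : sdet [ffun i => al (s i)] = (-1) ^+ s * sdet al.
Proof.
rewrite /sdet -det_perm -det_mulmx -row_permE; congr (\det _).
by apply/matrixP => k c; rewrite !mxE ffunE.
Qed.

(** All nonzero terms of the determinant have the same degree: the column offsets are 0, ..., N-1 in
    some order. *)
Lemma sdet_homog al l : coef (sdet al) l != 0 ->
  \sum_i al i = (psize l)%:Z + \sum_(i < N) (i : nat)%:Z.
Proof.
rewrite sdetE coef_sum => /eqP nz; apply/eqP; case: eqP => // e; case: nz.
apply: big1 => s _; rewrite mulr_sign.
suff h : coef (\prod_i hz (al i - (rev_ord (s i) : nat)%:Z)) l = 0.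
  by case: odd_perm; rewrite ?coefN h ?oppr0.
case: (boolP [exists i, al i - (rev_ord (s i) : nat)%:Z < 0]) => [/existsP[i ai]|a0].
  by rewrite (bigD1 i) // (hz_neg ai) -[X in coef X _]/(0 * _) mul0r coef0.
rewrite (@homog_prod 'I_N (index_enum _)
  (fun i => absz (al i - (rev_ord (s i) : nat)%:Z)) (fun i =>
    hz (al i - (rev_ord (s i) : nat)%:Z))
  (fun i => @homog_hz _)) //; apply/eqP => ls; apply: e.
rewrite ls (big_morph Posz PoszD (erefl _)).
have -> : \sum_(i < N) (i : nat)%:Z = \sum_i (rev_ord (s i) : nat)%:Z.
  rewrite (reindex_inj (inj_comp rev_ord_inj (@perm_inj _ s))) //=.
rewrite -big_split; apply: eq_bigr => i _; move/existsPn: a0 => /(_ i).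
by move: (al i) (nat_of_ord (rev_ord (s i))) => x y /=; lia.
Qed.

Definition Psum n al := \sum_i sdet (sh i n%:Z al).

(** Raising i and raising j give determinants that differ by a row exchange and cancel; raising any
    other exponent leaves rows i and j equal. *)
Lemma Psum_dup n al i j : i != j -> al i = al j -> Psum n al = 0.
Proof.
move=> ij e; rewrite /Psum (bigD1 i) // (bigD1 j) 1?eq_sym //=.
rewrite big1 ?addr0 => [|k /andP[ki kj]]; last first.
  apply: (@sdet_dup _ i j ij); rewrite !shE.
  by rewrite ![_ == k]eq_sym (negPf ki) (negPf kj).
apply/eqP; rewrite addr_eq0; apply/eqP; apply: (@sdet_swap _ _ i j) => //.
- by rewrite !shE !eqxx e.
- by rewrite !shE [j == i]eq_sym (negPf ij) e.
- by move=> k ki kj; rewrite !shE (negPf ki) (negPf kj).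
Qed.

(** If al = la + delta, this says that at least n of the N parts of la are zero. *)
Definition low n al := forall x : nat, (x < n)%N -> exists i, al i = x%:Z.

(** Only raising exponent i itself can remove the negative entry. The result is still negative or
    lies in [0, n), where [low] provides an equal exponent. *)
Lemma Psum_neg n al i : low n al -> al i < 0 -> Psum n al = 0.
Proof.
move=> la ai; apply: big1 => j _.
have [ji|ij] := eqVneq i j; last first.
  by apply: (@sdet_neg _ i); rewrite shE (negPf ij).
have [neg|nneg] := ltP (al i + n%:Z) 0.
  by apply: (@sdet_neg _ i); rewrite shE ji eqxx -ji.
have [k ak] : exists k, al k = absz (al i + n%:Z) by apply: la; lia.
have ki : k != i by apply: contraTneq ai => <-; rewrite ak.
apply: (@sdet_dup _ k i ki); rewrite !shE -ji eqxx (negPf ki) ak; lia.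
Qed.

Lemma card_low n al : injective al -> (forall i, 0 <= al i) -> low n al ->
  #|[pred i | al i < n%:Z]| = n.
Proof.
move=> ia a0 la; pose s := [seq absz (al i) | i <- enum [pred i | al i < n%:Z]].
have -> : #|[pred i | al i < n%:Z]| = size s by rewrite size_map cardE.
rewrite -[RHS](size_iota 0); apply: perm_size; apply: uniq_perm.
- rewrite map_inj_in_uniq ?enum_uniq // => i j _ _ e; apply: ia.
  by move: (a0 i) (a0 j) e; lia.
- exact: iota_uniq.
- move=> x; rewrite mem_iota add0n /=; apply/mapP/idP => [[i]|xn].
    by rewrite mem_enum inE => ai ->; move: (a0 i); lia.
  by have [i ai] := la _ xn; exists i; rewrite ?mem_enum ?inE ai //; lia.
Qed.

Lemma sum_iota_uniq (s : seq nat) : uniq s -> (\sum_(i < size s) i <= sumn s)%N.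
Proof.
move=> us; have : (\sum_(i < size s) i <= \sum_(i <- s) i)%N; last by rewrite sumnE.
have := sort_sorted leq_total s; have : perm_eq (sort leq s) s by rewrite perm_sort.
move: (sort leq s) => t pt st.
rewrite -(perm_big _ pt) -(perm_size pt) /=.
have ut : uniq t by rewrite (perm_uniq pt).
have {}st : sorted ltn t by rewrite ltn_sorted_uniq_leq ut.
rewrite (big_nth 0%N) big_mkord; apply: leq_sum => i _.
elim: (i : nat) (ltn_ord i) => // k IH kt.
apply: leq_ltn_trans (IH (ltnW kt)) _.
by move/(sortedP 0%N): st; apply.
Qed.

Lemma sum_inj al : injective al -> (forall i, 0 <= al i) ->
  \sum_(i < N) (i : nat)%:Z <= \sum_i al i.
Proof.
move=> ia a0; pose s := [seq absz (al i) | i <- enum 'I_N].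
have us : uniq s.
  rewrite map_inj_uniq ?enum_uniq // => i j e; apply: ia.
  by move: (a0 i) (a0 j) e; lia.
have := sum_iota_uniq us; rewrite /s size_map size_enum_ord sumnE big_map big_enum /=.
have -> : \sum_i al i = \sum_i (absz (al i))%:Z by apply: eq_bigr => i _; move: (a0 i);
  lia.
by rewrite -!(big_morph Posz PoszD (erefl _)) lez_nat.
Qed.

(* Shifting down the entries above a missing value x keeps al injective. *)
Lemma sum_inj_miss al (x : nat) : injective al -> (forall i, 0 <= al i) ->
  (x < N)%N -> (forall i, al i <> x%:Z) ->
  \sum_(i < N) (i : nat)%:Z + N%:Z - x%:Z <= \sum_i al i.
Proof.
move=> ia a0 xN ax.
pose be : A := [ffun i => al i - (x%:Z < al i)%R%:R].
have ib : injective be.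
  move=> i j; rewrite !ffunE => e; apply: ia; move: e (ax i) (ax j).
  by case: ltP; case: ltP; lia.
have b0 i : 0 <= be i by rewrite ffunE; move: (a0 i) (ax i); case: ltP; lia.
have sb := sum_inj ib b0.
have : \sum_i al i = \sum_i be i + #|[pred i | x%:Z < al i]|%:Z.
  rewrite -sum1_card (big_morph Posz PoszD (erefl _)) [X in _ + X]big_mkcond
    -[RHS]big_split /=.
  by apply: eq_bigr => i _; rewrite ffunE inE; case: ltP; rewrite ?subrK ?subr0 ?addr0.
suff : (N - x <= #|[pred i | (x%:Z < al i)%R]|)%N by lia.
have -> : #|[pred i | x%:Z < al i]| = (N - #|[pred i | (al i < x%:Z)%R]|)%N.
  rewrite -[X in (X - _)%N](card_ord N) -(cardC [pred i | al i < x%:Z]) addKn.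
  by apply: eq_card => i; rewrite !inE; move: (ax i); lia.
suff : (#|[pred i | (al i < x%:Z)%R]| <= x)%N by lia.
pose s := [seq absz (al i) | i <- enum [pred i | al i < x%:Z]].
have -> : #|[pred i | al i < x%:Z]| = size s by rewrite size_map cardE.
rewrite -[leqRHS](size_iota 0); apply: uniq_leq_size.
  rewrite map_inj_in_uniq ?enum_uniq // => i j _ _ e; apply: ia.
  by move: (a0 i) (a0 j) e; lia.
move=> y /mapP[i]; rewrite mem_enum inE => ai ->.
by rewrite mem_iota; move: (a0 i); lia.
Qed.

(* Multiplication by p_n adds n to one exponent; both sides have the same
   D m for all m, where [D m, p_n] = n delta_(m, n) comes from the exponents
   smaller than n. *)
Lemma psum_sdet n al : (0 < n)%N -> low n al -> psum n * sdet al = Psum n al.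
Proof.
move=> n0 la.
have [/existsP[i ai]|] := boolP [exists i, al i < 0].
  by rewrite (sdet_neg ai) mulr0 (Psum_neg la ai).
move/existsPn => a0; have {}a0 i : 0 <= al i by move: (a0 i); lia.
have [t] := ubnP (absz (\sum_i al i)); elim: t al la a0 => // t IH al la a0 at_.
have [/injectiveP ia|/injectivePn[i [j ij e]]] := boolP (injectiveb al); last first.
  by rewrite (sdet_dup ij e) (Psum_dup _ ij e) mulr0.
have s0 (be : A) : (forall i, 0 <= be i) -> 0 <= \sum_i be i.
  by move=> b0; apply: sumr_ge0 => i _.
apply/eqP; rewrite -subr_eq0; apply/eqP; apply: D_eq0 => [m m0|]; last first.
  rewrite coefB coefM0 coef_psum0 mul0r sub0r coef_sum big1 ?oppr0 // => i _.
  apply/eqP; apply: contraT => /sdet_homog; rewrite sum_sh.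
  by have := sum_inj ia a0; rewrite /psize /=; lia.
(* Exponent j is lowered first and some exponent raised afterwards. The correction [sdet al] arises
   when the lowered exponent is negative and raising it by n = m restores [al]. *)
have key j : Psum n (sh j (- m%:Z) al) = psum n * sdet (sh j (- m%:Z) al)
    + ((al j < n%:Z)%R && (m == n))%:R *: sdet al.
  have [jn|nj] := ltP (al j) n%:Z; last first.
    rewrite scale0r addr0.
    have lb : low n (sh j (- m%:Z) al).
      move=> x xn; have [i ai] := la x xn; exists i; rewrite shE.
      by have [e|//] := eqVneq i j; move: nj ai; rewrite e; lia.
    have [jm|mj] := ltP (al j) m%:Z.
      have nb : sh j (- m%:Z) al j < 0 by rewrite shE eqxx; lia.
      by rewrite (sdet_neg nb) (Psum_neg lb nb) mulr0.
    have b0 i : 0 <= sh j (- m%:Z) al i.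
      by rewrite shE; have [->|_] := eqVneq i j; rewrite ?a0 //; lia.
    rewrite IH //; move: (s0 _ b0) (s0 _ a0) at_; rewrite sum_sh.
    by move: (\sum_i _) => z; lia.
  (* Now al j < n. Every other value in [0, n) belongs to another exponent, so a shift of exponent j
     into that interval repeats a row. *)
  have [mj|jm] := leP m%:Z (al j).
    have [k ak] : exists k, al k = (absz (al j - m%:Z))%:Z by apply: la; lia.
    have kj : k != j by apply: contra_eqN ak => /eqP ->; lia.
    have e : sh j (- m%:Z) al k = sh j (- m%:Z) al j.
      by rewrite !shE eqxx (negPf kj) ak; lia.
    rewrite (sdet_dup kj e) (Psum_dup _ kj e) mulr0 add0r.
    by rewrite (_ : (m == n) = false) ?scale0r //; lia.
  have nb : sh j (- m%:Z) al j < 0 by rewrite shE eqxx; lia.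
  rewrite (sdet_neg nb) mulr0 add0r /Psum (bigD1 j) //= big1 ?addr0 => [|i ij].
    rewrite shD; have [->|mn] := eqVneq m n; first by rewrite subrr sh0 scale1r.
    rewrite scale0r; have [neg|pos] := ltP (al j + (n%:Z - m%:Z)) 0.
      by apply: (@sdet_neg _ j); rewrite shE eqxx.
    have [k ak] : exists k, al k = (absz (al j + (n%:Z - m%:Z)))%:Z by apply: la; lia.
    have kj : k != j by apply: contra_eqN ak => /eqP ->; lia.
    by apply: (sdet_dup kj); rewrite !shE eqxx (negPf kj) ak; lia.
  by apply: (@sdet_neg _ j); rewrite shE eq_sym (negPf ij).
rewrite linearB /= DM D_psum // D_sdet // /Psum linear_sum /=.
have -> : \sum_i D m (sdet (sh i n%:Z al)) = \sum_j Psum n (sh j (- m%:Z) al).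
  under eq_bigr do rewrite D_sdet //.
  rewrite exchange_big; apply: eq_bigr => j _; apply: eq_bigr => i _.
  by rewrite shC.
rewrite (eq_bigr _ (fun j _ => key j)) big_split /= -mulr_sumr mulr_algl.
rewrite opprD addrA addrK -scaler_suml.
suff -> : \sum_j ((al j < n%:Z)%R && (m == n))%:R = (m * (m == n))%:R :> rat.
  by rewrite subrr.
have [->|_] := eqVneq m n; last by rewrite muln0 big1 // => j _; rewrite andbF.
under eq_bigr do rewrite andbT.
by rewrite -natr_sum muln1 -[in RHS](card_low ia a0 la) -sum1_card [in RHS]big_mkcond.
Qed.

End Tuples.

(** * The telescoping sum of hook signs *)

Section WindowSign.

Variables (b : pred nat) (n : nat).
Hypothesis n_gt0 : (0 < n)%N.

(* The sign (-1)^(number of y with b y and x < y < x + n). *)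
Definition window x : int := \prod_(1 <= t < n) (-1) ^+ b (x + t)%N.

(** A bit y contributes -1 strictly between x and x + n, 0 at the two ends and 1 elsewhere. The
    exempted z is the exponent being moved: z = x when it is raised from x, z = x + n when it is
    lowered to x. In both cases z is an end of the window, and the sign correction is void. *)
Lemma prod_window (x z K : nat) : (x + n < K)%N ->
  \prod_(0 <= y < K | b y) (if y == z then 1
    else Num.sg (x%:Z + n%:Z - y%:Z) * Num.sg (x%:Z - y%:Z)) =
  (b x ==> (x == z))%:R * (b (x + n)%N ==> (x + n == z)%N)%:R *
  (if (x < z < x + n)%N && b z then - window x else window x).
Proof.
move=> xK; rewrite big_mkcond (@big_cat_nat _ _ _ x) //=; last by lia.
rewrite [X in X * _ = _]big_nat [X in X * _ = _]big1 ?mul1r => [|y yx]; last first.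
  by case: ifP => // _; case: ifP => // _; rewrite !gtr0_sg ?mulr1 //; lia.
rewrite big_ltn; last by lia.
rewrite (@big_cat_nat _ _ _ (x + n)) //=; [|lia|lia].
rewrite [X in _ * (_ * X) = _]big_ltn //.
rewrite [X in _ * (_ * (_ * X)) = _]big_nat [X in _ * (_ * (_ * X)) =
  _]big1 ?mulr1 => [|y yx]; last first.
  by case: ifP => // _; case: ifP => // _; rewrite !ltr0_sg ?mulrNN //; lia.
rewrite subrr sgr0 mulr0 [_ + _ - _](_ : _ = 0) ?sgr0 ?mul0r; last by lia.
have -> : \prod_(x.+1 <= y < x + n) (if b y then if y == z then 1
    else Num.sg (x%:Z + n%:Z - y%:Z) * Num.sg (x%:Z - y%:Z) else 1) =
  (if (x < z < x + n)%N && b z then - window x else window x).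
  transitivity (\prod_(x.+1 <= y < x + n) ((-1) ^+ b y * (-1) ^+ (b y && (y == z))) :
    int).
    rewrite big_nat [RHS]big_nat; apply: eq_bigr => y yx.
    case: (b y) => //=; case: eqP => // _.
    by rewrite gtr0_sg ?ltr0_sg //; lia.
  rewrite big_split /=.
  have -> : \prod_(x.+1 <= y < x + n) (-1) ^+ b y = window x.
    rewrite -{1}[x.+1]addn1 -{1}[x]add0n -addnA [(x + 1)%N]addnC addnA add0n.
    by rewrite big_addn addKn; apply: eq_bigr => t _; rewrite addnC.
  case: ifP => [/andP[zx bz]|/negP zx].
    rewrite (bigD1_seq z) ?iota_uniq ?mem_index_iota //= eqxx bz /=.
    rewrite big1 ?mulr1 ?mulrN1 // => y /negPf ->; by rewrite andbF.
  rewrite big_nat big1 ?mulr1 // => y yx.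
  by case: (boolP (b y)) => //= yb; case: eqP => // yz; case: zx; rewrite -yz yb andbT.
by case: (b x); case: (x == z); case: (b (x + n)%N); case: (x + n == z)%N;
  rewrite /= ?mul1r ?mulr1 ?mul0r ?mulr0.
Qed.

Lemma sum_window (K : nat) : (forall x, (K <= x)%N -> ~~ b x) ->
  (forall x, (x < n)%N -> b x) ->
  \sum_(0 <= x < K) ((b x && ~~ b (x + n)%N)%:R - (~~ b x && b (x + n)%N)%:R) * window x
  = (odd n)%:R.
Proof.
(* Adding an end point to the window gives W(x) or W(x+1), so that W(x+1) - W(x) is twice the
   summand. The sum of these differences is W(K) - W(0) = 1 - (-1)^n. *)
move=> bK bn; pose W x : int := \prod_(0 <= t < n) (-1) ^+ b (x + t)%N.
have W0 x : W x = (-1) ^+ b x * window x by rewrite /W big_ltn // addn0.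
have W1 x : W x.+1 = window x * (-1) ^+ b (x + n)%N.
  rewrite /W /window -(prednK n_gt0) big_nat_recr //= big_add1 /=.
  by rewrite addnS; congr (_ * _); apply: eq_bigr => t _; rewrite addnS.
apply: (@mulfI _ 2) => //; rewrite mulr_sumr.
transitivity (\sum_(0 <= x < K) (W x.+1 - W x)).
  apply: eq_bigr => x _; rewrite W1 W0.
  by case: (b x); case: (b (x + n)%N) => /=; ring.
rewrite telescope_sumr // [W K]big1 => [|t _]; last first.
  by rewrite (negPf (bK _ (leq_addr _ _))).
rewrite [W 0](_ : _ = (-1) ^+ n).
  by rewrite -signr_odd; case: odd; rewrite /= ?expr0 ?expr1 ?mulr0 ?mulr1 ?subrr.
rewrite /W big_nat (eq_bigr (fun=> -1)) => [|t tn]; last by rewrite add0n bn.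
by rewrite -big_nat prodr_const_nat subn0.
Qed.

End WindowSign.

(** * Signs of exponent vectors under shifts *)

Section Sign.

Variable N : nat.
Local Notation A := {ffun 'I_N -> int}.
Implicit Types (al be : A) (s : 'S_N).

(** The sign of the permutation that sorts [al] decreasingly, or 0 if two exponents coincide. *)
Definition vsgn al : int := \prod_(i < N) \prod_(j < N | (i < j)%N) Num.sg (al i - al j).

Lemma vsgn_perm al s : vsgn [ffun i => al (s i)] = (-1) ^+ s * vsgn al.
Proof.
(* Negating the nodes turns the Vandermonde factors x_j - x_i, i < j, into be_i - be_j; a
   permutation of the nodes permutes the columns. *)
have sgE be : vsgn be = Num.sg (\det (Vandermonde N (\row_j - be j))).
  rewrite det_Vandermonde (big_morph _ (@sgrM _) (@sgr1 _)); apply: eq_bigr => i _.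
  rewrite (big_morph _ (@sgrM _) (@sgr1 _)); apply: eq_bigr => j _.
  by rewrite !mxE opprK addrC.
rewrite !sgE (_ : Vandermonde N _ = col_perm s (Vandermonde N (\row_j - al j))).
  by rewrite col_permE det_mulmx det_perm sgrM odd_permV mulrC; case: odd_perm;
    rewrite ?expr1 ?sgrN sgr1.
by apply/matrixP => i j; rewrite !mxE ffunE.
Qed.

Lemma vsgn_decr al : (forall i j : 'I_N, (i < j)%N -> al j < al i) -> vsgn al = 1.
Proof.
move=> d; rewrite /vsgn big1 // => i _; rewrite big1 // => j ij.
by rewrite gtr0_sg // subr_gt0 d.
Qed.

(** Serves to compare the signs before and after a shift of exponent i, where all pairs not
    involving i cancel. *)
Lemma prod_ltn_sym (i : 'I_N) (G : 'I_N -> 'I_N -> int) :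
  (forall p q, G p q = G q p) ->
  (forall p q, p != q -> p != i -> q != i -> G p q = 1) ->
  \prod_(p < N) \prod_(q < N | (p < q)%N) G p q = \prod_(k | k != i) G i k.
Proof.
move=> Gs G1; rewrite (bigD1 i) //= [RHS](bigID (fun k : 'I_N => (k < i)%N)) /= mulrC.
congr (_ * _); last first.
  apply: eq_bigl => k; rewrite -leqNgt -(inj_eq val_inj) /= ltn_neqAle eq_sym.
  by [].
rewrite [RHS]big_mkcondr; apply: eq_bigr => p pi; case: ifP => pi'.
  rewrite (bigD1 i) //= Gs big1 ?mulr1 // => q /andP[pq qi]; apply: G1 => //.
  by rewrite -(inj_eq val_inj) ltn_eqF.
rewrite big1 // => q pq; apply: G1 => //; first by rewrite -(inj_eq val_inj) ltn_eqF.
by apply: contraFneq pi' => <-.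
Qed.

(** For injective [al] the sign squares to 1, so the ratio of the two signs is their product, which
    can be formed pair by pair. *)
Lemma vsgn_sh al i x : injective al -> vsgn (sh i x al) =
  vsgn al * \prod_(k | k != i) (Num.sg (al i + x - al k) * Num.sg (al i - al k)).
Proof.
move=> ia; set be := sh i x al.
have sg1 p q : p != q -> Num.sg (al p - al q) ^+ 2 = 1.
  by move=> pq; rewrite sqr_sg subr_eq0 (inj_eq ia) pq.
have v2 : vsgn al ^+ 2 = 1.
  rewrite -prodrXl big1 // => p _; rewrite -prodrXl big1 // => q pq.
  by rewrite sg1 // -(inj_eq val_inj) ltn_eqF.
rewrite -[LHS]mulr1 -[X in _ * X = _]v2 expr2 mulrA mulrC; congr (_ * _).
rewrite -big_split /=; under eq_bigr do rewrite -big_split /=.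
rewrite (@prod_ltn_sym i (fun p q => Num.sg (be p - be q) * Num.sg (al p - al q))).
- by apply: eq_bigr => k /negPf ki; rewrite !shE eqxx ki.
- by move=> p q; rewrite -(opprB (be q)) -(opprB (al q)) !sgrN mulrNN.
- move=> p q pq /negPf pi /negPf qi; rewrite !shE pi qi -expr2; exact: sg1.
Qed.

Definition bits al : pred nat := fun x => [exists i, al i == x%:Z].

Lemma big_bits (R : Type) (idx : R) (op : Monoid.com_law idx) al (K : nat) (F : nat ->
  R) :
  injective al -> (forall i, 0 <= al i < K%:Z) ->
  \big[op/idx]_i F (absz (al i)) = \big[op/idx]_(0 <= x < K | bits al x) F x.
Proof.
move=> ia a0; rewrite -[RHS]big_filter -(big_map (fun i => absz (al i)) xpredT F).
apply: perm_big; apply: uniq_perm.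
- rewrite map_inj_uniq ?index_enum_uniq // => i j e; apply: ia.
  by move: (a0 i) (a0 j) e; lia.
- by rewrite filter_uniq ?iota_uniq.
move=> x; rewrite mem_filter mem_index_iota /=.
apply/mapP/andP => [[i _ ->]|[/existsP[i /eqP ai] _]].
  split; last by move: (a0 i); lia.
  by apply/existsP; exists i; apply/eqP; move: (a0 i); lia.
by exists i; rewrite ?mem_index_enum // ai.
Qed.

(** In terms of bits, raising i counts the x with b(x) and not b(x+n), lowering i those with b(x+n)
    and not b(x), each with the sign of the window at x. The difference is the sum in
    [sum_window]. *)
Lemma sum_vsgn n al : (0 < n)%N -> injective al -> (forall i, 0 <= al i) -> low n al ->
  \sum_i (vsgn (sh i n%:Z al) - (n%:Z <= al i)%R%:R * vsgn (sh i (- n%:Z) al)) =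
  (odd n)%:R * vsgn al.
Proof.
move=> n0 ia a0 la; pose K := (\max_i absz (al i)).+1; pose b := bits al.
have aK i : 0 <= al i < K%:Z.
  by have := leq_bigmax (F := fun i => absz (al i)) i; move: (a0 i); rewrite /K; lia.
have aK' m i : 0 <= al i < (K + m)%N%:Z by move: (aK i); lia.
have bK x : (K <= x)%N -> ~~ b x.
  by move=> Kx; apply/existsPn => i; apply/eqP; move: (aK i); lia.
have bn x : (x < n)%N -> b x.
  by move=> /la[i ai]; apply/existsP; exists i; rewrite ai.
have ba i : b (absz (al i)) by apply/existsP; exists i; apply/eqP; move: (a0 i); lia.
have up i : vsgn (sh i n%:Z al) =
  vsgn al * ((~~ b (absz (al i) + n)%N)%:R * window b n (absz (al i))).
  rewrite vsgn_sh //; congr (_ * _); set x := absz (al i).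
  have ax : al i = x%:Z by move: (a0 i); rewrite /x; lia.
  pose F (y : nat) : int := if y == x then 1 else Num.sg (x%:Z + n%:Z - y%:Z) * Num.sg
    (x%:Z - y%:Z).
  transitivity (\prod_k F (absz (al k))).
    rewrite [RHS](bigD1 i) //= /F eqxx mul1r; apply: eq_bigr => k ki.
    rewrite ifF; last first.
      by apply: contraNF ki => /eqP e; apply/eqP/ia; move: (a0 k) (a0 i) e; rewrite /x;
        lia.
    by rewrite ax; congr (Num.sg (_ - _) * Num.sg (_ - _)); move: (a0 k); lia.
  rewrite (@big_bits _ _ _ _ (K + n).+1 F) //; last by move=> k; move: (aK k); lia.
  rewrite prod_window //; last by move: (aK i); rewrite ax; lia.
  rewrite -/b ba eqxx mul1r (_ : (x + n == x)%N = false); last by apply/eqP; lia.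
  by rewrite implybF ltnn.
have dn i : (n%:Z <= al i)%R%:R * vsgn (sh i (- n%:Z) al) =
   vsgn al * ((n <= absz (al i))%N%:R * ((~~ b (absz (al i) - n)%N)%:R * window b n
     (absz (al i) - n))).
  have [ni|nni] := boolP (n%:Z <= al i); last first.
    have [nx|_] := boolP (n <= absz (al i))%N; first by move: (a0 i); lia.
    by rewrite !mul0r mulr0.
  have -> : (n <= absz (al i))%N by lia.
  rewrite !mul1r vsgn_sh //; congr (_ * _); set x := (absz (al i) - n)%N.
  have ax : al i = (x + n)%N%:Z by rewrite /x; lia.
  pose F (y : nat) : int := if y == (x + n)%N then 1 else Num.sg (x%:Z + n%:Z - y%:Z) *
    Num.sg (x%:Z - y%:Z).
  transitivity (\prod_k F (absz (al k))).
    rewrite [RHS](bigD1 i) //= {1}/F ifT ?mul1r; last by rewrite ax.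
    apply: eq_bigr => k ki; rewrite /F ifF; last first.
      by apply: contraNF ki => /eqP e; apply/eqP/ia; move: (a0 k) e; rewrite ax; lia.
    by rewrite mulrC ax; congr (Num.sg _ * Num.sg _); move: (a0 k); lia.
  rewrite (@big_bits _ _ _ _ (K + n).+1 F) //; last by move=> k; move: (aK k); lia.
  rewrite prod_window //; last by move: (aK i); rewrite ax; lia.
  have -> : bits al (x + n)%N by apply/existsP; exists i; rewrite ax.
  rewrite -/b eqxx mulr1 (_ : (x == x + n)%N = false); last by apply/eqP; lia.
  by rewrite implybF ltnn andbF.
under eq_bigr do rewrite up dn.
rewrite -[RHS]mulrC -(sum_window n0 bK bn) sumrB -!mulr_sumr -mulrBr; congr (_ * _).
pose U x : int := (~~ b (x + n)%N)%:R * window b n x.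
pose V x : int := (n <= x)%N%:R * ((~~ b (x - n)%N)%:R * window b n (x - n)).
(* The lowering sum gets the longer range K + n: dropping its n vanishing first terms and reindexing
   by n brings it to the range of the raising sum. *)
rewrite (@big_bits _ _ _ _ K U) // (@big_bits _ _ _ _ (K + n) V) //.
rewrite [X in _ - X](@big_cat_nat _ _ _ n) //=; last by lia.
rewrite [X in _ - (X + _)]big_nat_cond [X in _ - (X + _)]big1 ?add0r =>
  [|x /andP[xn _]]; last first.
  by rewrite /V leqNgt; case/andP: xn => _ ->; rewrite mul0r.
rewrite (big_addn 0 _ n) addnK [X in X - _]big_mkcond [X in _ - X]big_mkcond -sumrB;
  apply: eq_bigr => x _ /=.
rewrite /U /V leq_addl addnK mul1r -/b.
by case: (b x); case: (b (x + n)%N);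
  rewrite /= ?subr0 ?sub0r ?mul0r ?mul1r ?mulN1r ?subrr.
Qed.

End Sign.

(** * The signed sum over all integer vectors *)

Section Tot.

Variable N : nat.
Local Notation A := {ffun 'I_N -> int}.
Implicit Types (al be : A) (s : 'S_N).

(** Summing with finite support over all vectors makes a shift of one exponent a plain reindexing;
    [box], on which actual sums are computed, is not stable under shifts. *)
Definition tot (F : A -> rat) : rat := \sum_(al \in [set: A]) F al.

Lemma tot_seq (r : seq A) F : uniq r -> (forall al, al \notin r -> F al = 0) ->
  tot F = \sum_(al <- r) F al.
Proof.
move=> ur rF; rewrite /tot (@fsbigE _ _ _ _ _ r) //; last by move=> al _; exact: rF.
by apply: eq_bigl => al; rewrite mem_set.
Qed.

Lemma tot_sh i (x : int) F : tot (fun al => F (sh i x al)) = tot F.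
Proof.
symmetry; apply: reindex_fsbigT; exists (sh i (- x)) => al.
  by rewrite shD addNr sh0.
by rewrite shD subrr sh0.
Qed.

Definition box B : seq A := [seq [ffun i =>
  (f i : nat)%:Z - B%:Z] | f : {ffun 'I_N -> 'I_B.*2.+1}].

Lemma box_uniq B : uniq (box B).
Proof.
rewrite map_inj_uniq ?enum_uniq // => f g /ffunP e; apply/ffunP => i.
by apply: val_inj; have := e i; rewrite !ffunE /=; lia.
Qed.

Lemma mem_box B al : (forall i, `|al i| <= B%:Z) -> al \in box B.
Proof.
move=> h; apply/mapP; exists [ffun i => inord (absz (al i + B%:Z))];
  first by rewrite mem_enum.
apply/ffunP => i; rewrite !ffunE inordK; last by move: (h i); lia.
by rewrite gez0_abs ?addrK //; move: (h i); lia.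
Qed.

(* With this sign, summing esgn al *: sdet al over all al counts every Schur
   function N! times, so that the sum is invariant under reindexing by sh. *)
Definition esgn al : rat := if [forall i, 0 <= al i] then (vsgn al)%:~R else 0.

Lemma esgn_nonneg al : esgn al != 0 -> forall i, 0 <= al i.
Proof. by rewrite /esgn; case: ifP => [/forallP//|]; rewrite eqxx. Qed.

Lemma ge_entry al i : (forall j, 0 <= al j) -> al i <= \sum_j al j.
Proof. by move=> a0; rewrite (bigD1 i) //= lerDl sumr_ge0. Qed.

Lemma sdet_inj al l : coef (sdet al) l != 0 -> injective al.
Proof.
move=> nz i j e; apply/eqP; apply: contraNT nz => ij.
by rewrite (sdet_dup ij e).
Qed.

Lemma sdet_nonneg al l : coef (sdet al) l != 0 -> forall i, 0 <= al i.
Proof.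
move=> nz i; rewrite leNgt; apply: contraNN nz => ai.
by rewrite (sdet_neg ai).
Qed.

(** By [sum_inj_miss], a missing value x < n would raise the sum by at least N - x, which exceeds N
    - n. *)
Lemma low_of_sum n al : injective al -> (forall i, 0 <= al i) -> (n <= N)%N ->
  \sum_i al i <= \sum_(i < N) (i : nat)%:Z + N%:Z - n%:Z -> low n al.
Proof.
move=> ia a0 nN le x xn; case: (boolP [exists i, al i == x%:Z]) => [/existsP[i /eqP ai]|].
  by exists i.
move/existsPn => ax; have xN : (x < N)%N by lia.
have := sum_inj_miss ia a0 xN (fun i => elimN eqP (ax i)).
by move: le; move: (\sum_i _) (\sum_(i < N) _) => y z; lia.
Qed.

(** Either the sum of the exponents is small enough to force [low], and [psum_sdet] applies, or both
    series have degree above psize l, by the bound on N. *)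
Lemma coef_psum_sdet n al l : (0 < n)%N -> (psize l + n <= N)%N -> esgn al != 0 ->
  coef (psum n * sdet al) l = coef (Psum n al) l.
Proof.
move=> n0 lN /esgn_nonneg a0.
have [/injectiveP ia|/injectivePn[i [j ij e]]] := boolP (injectiveb al); last first.
  by rewrite (sdet_dup ij e) (Psum_dup _ ij e) mulr0.
have [le|gt] := leP (\sum_i al i) (\sum_(i < N) (i : nat)%:Z + N%:Z - n%:Z).
  by rewrite psum_sdet //; apply: low_of_sum => //; lia.
have -> : coef (Psum n al) l = 0.
  rewrite coef_sum big1 // => i _; apply/eqP; apply: contraLR gt => /sdet_homog.
  rewrite sum_sh -leNgt; move: (\sum_i _) (\sum_(i < N) _) => y z; lia.
have [nl|nl] := boolP (n \in parts l); last by rewrite coef_psumM_notin.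
have [a la] := padd_ex nl; move: lN; rewrite la coef_psumM // psize_padd // => lN.
apply/eqP; apply: contraLR gt => /sdet_homog.
by rewrite -leNgt; move: (\sum_i _) (\sum_(i < N) _) => y z; lia.
Qed.

Definition Stot B : symser := \sum_(al <- box B) esgn al *: sdet al.

Lemma D_Stot n l B : (0 < n)%N -> (psize l + n <= N)%N ->
  (psize l + n + \sum_(i < N) i + n <= B)%N ->
  coef (D n (Stot B)) l = coef (psum n * Stot B + (odd n)%:R *: Stot B) l.
Proof.
move=> n0 lN lB.
(* A vector [be] whose determinant contributes at [l] has nonnegative entries of known sum, hence
   bounded entries; the box leaves room for a further shift by n. *)
have box1 (c : rat) al be : c * coef (sdet be) l != 0 ->
    (forall i, `|al i - be i| <= n%:Z) -> al \in box B.
  rewrite mulf_eq0 negb_or => /andP[_ nz] ab; apply: mem_box => i.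
  have bb := sdet_nonneg nz; have := ge_entry i bb; rewrite (sdet_homog nz).
  rewrite -(big_morph Posz PoszD (erefl _)); move: lB (ab i) (bb i).
  by move: (\sum_(j < N) j)%N => z; lia.
have totE (c : A -> rat) (g : A -> A) : (forall al i, `|al i - g al i| <= n%:Z) ->
    tot (fun al => c al * coef (sdet (g al)) l) =
    \sum_(al <- box B) c al * coef (sdet (g al)) l.
  move=> gb; apply: tot_seq; first exact: box_uniq.
  by move=> al; apply: contraNeq => nz; apply: box1 nz (gb al).
have shb i (x : int) al : `|x| <= n%:Z -> forall j, `|al j - sh i x al j| <= n%:Z.
  move=> xn j; rewrite shE; case: ifP => _; last by rewrite subrr normr0.
  by rewrite opprD addNKr normrN.
have nn : `|n%:Z| <= n%:Z by lia.
have nn' : `|- n%:Z| <= n%:Z by lia.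
(* Undoing the shift in the index collects, for each fixed [sdet al], the signs of the vectors that
   lead to [al]. *)
have E1 : coef (D n (Stot B)) l =
    \sum_i tot (fun al => esgn (sh i n%:Z al) * coef (sdet al) l).
  have -> : D n (Stot B) = \sum_(al <- box B) D n (esgn al *: sdet al) by exact:
    linear_sum.
  rewrite coef_sum.
  under eq_bigr do rewrite DZ D_sdet // coefZ coef_sum mulr_sumr.
  rewrite exchange_big; apply: eq_bigr => i _.
  rewrite -(totE esgn (sh i (- n%:Z))) => [|al]; last exact: shb.
  rewrite -[RHS](tot_sh i (- n%:Z)); apply: eq_fsbigr => al _ /=.
  by rewrite shD subrr sh0.
have E2 : coef (psum n * Stot B) l =
    \sum_i tot (fun al => esgn (sh i (- n%:Z) al) * coef (sdet al) l).
  rewrite mulr_sumr coef_sum.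
  transitivity (\sum_(al <- box B) \sum_i esgn al * coef (sdet (sh i n%:Z al)) l).
    apply: eq_bigr => al _; rewrite -scalerAr coefZ.
    have [->|nz] := eqVneq (esgn al) 0.
      by rewrite mul0r big1 // => i _; rewrite mul0r.
    by rewrite coef_psum_sdet // coef_sum mulr_sumr.
  rewrite exchange_big; apply: eq_bigr => i _.
  rewrite -(totE esgn (sh i n%:Z)) => [|al]; last exact: shb.
  rewrite -[RHS](tot_sh i n%:Z); apply: eq_fsbigr => al _ /=.
  by rewrite shD addNr sh0.
have E3 : coef (Stot B) l = \sum_(al <- box B) esgn al * coef (sdet al) l.
  by rewrite coef_sum; apply: eq_bigr => al _; rewrite coefZ.
have totE0 c : tot (fun al => c al * coef (sdet al) l) =
    \sum_(al <- box B) c al * coef (sdet al) l.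
  by apply: (totE c id) => al i; rewrite subrr normr0.
rewrite coefD coefZ E1 E2 E3.
under eq_bigr do rewrite totE0. under [X in _ = X + _]eq_bigr do rewrite totE0.
rewrite exchange_big [X in _ = X + _]exchange_big mulr_sumr -big_split /=.
apply: eq_bigr => al _; rewrite -!mulr_suml mulrA -mulrDl.
have [->|nz] := eqVneq (coef (sdet al) l) 0; first by rewrite !mulr0.
congr (_ * _); have ia := sdet_inj nz; have a0 := sdet_nonneg nz.
(* The degree psize l of [sdet al] is at most N - n, which excludes a missing value below n. *)
have la : low n al.
  apply: low_of_sum => //; first by lia.
  rewrite (sdet_homog nz); move: (\sum_(i < N) _) => z; lia.
have eal : esgn al = (vsgn al)%:~R by rewrite /esgn ifT //; apply/forallP.
rewrite eal; apply/eqP; rewrite addrC -subr_eq -sumrB; apply/eqP.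
transitivity ((\sum_i (vsgn (sh i n%:Z al) -
    (n%:Z <= al i)%R%:R * vsgn (sh i (- n%:Z) al)))%:~R : rat); last first.
  by rewrite sum_vsgn // intrM; case: odd.
rewrite (big_morph _ (@intrD _) (erefl _)); apply: eq_bigr => i _; rewrite intrB.
congr (_ - _).
  rewrite /esgn ifT //; apply/forallP => j; rewrite shE; move: (a0 j).
  by case: ifP => _; lia.
have [ni|ni] := boolP (n%:Z <= al i)%R.
  rewrite mul1r /esgn ifT //; apply/forallP => j; rewrite shE; move: (a0 j).
  by case: eqP => [->|] _; lia.
rewrite mul0r /esgn ifF //; apply/negP => /forallP /(_ i); rewrite shE eqxx.
by move: ni; lia.
Qed.

End Tot.

(** * Jacobi-Trudi matrices padded with zero parts *)

Definition JT l n : 'M[symser]_n := \matrix_(i < n, j < n)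
  if (i <= nth 0 l i + j)%N then hsym (nth 0 l i + j - i)%N else 0.

(** A zero part adds the row of the h_(j-n), which vanishes except for the last entry h_0 = 1. In
    this way all Schur functions of degree at most N become determinants of the same size N. *)
Lemma det_JT_S l n : (size l <= n)%N -> \det (JT l n.+1) = \det (JT l n).
Proof.
move=> ln; rewrite (expand_det_row _ ord_max) big_ord_recr /= big1 ?add0r => [|j _].
  rewrite mxE /= nth_default // leqnn add0n subnn mul1r /cofactor /=.
  rewrite addnn -mul2n exprM sqrrN expr1n expr1n mul1r; congr (\det _).
  by apply/matrixP => i j; rewrite !mxE !lift_max.
by rewrite mxE /= nth_default // add0n leqNgt ltn_ord /= mul0r.
Qed.

Lemma schur_JT l n : (size l <= n)%N -> schur l = \det (JT l n).
Proof.
elim: n => [|n IH].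
  by rewrite leqn0 => /eqP l0; rewrite /schur -/(JT l (size l)) l0.
rewrite leq_eqVlt => /orP[/eqP <- //|ln]; rewrite IH ?det_JT_S //; lia.
Qed.

Lemma sum_nth_part l n : (size l <= n)%N -> (\sum_(i < n) nth 0 l i = psize l)%N.
Proof.
move=> ln; rewrite -(big_mkord xpredT (fun i => nth 0%N l i)).
rewrite (@big_cat_nat _ _ _ (size l)) //= [X in (_ + X)%N]big_nat.
rewrite [X in (_ + X)%N]big1 ?addn0; last by move=> i /andP[li _]; rewrite nth_default.
by rewrite /psize sumnE [RHS](big_nth 0%N).
Qed.

Lemma size_part l : (size l <= psize l)%N.
Proof.
elim/part_ind: l => // n l n0 IH; rewrite psize_padd //.
by rewrite (perm_size (padd_perm l n0)) /=; lia.
Qed.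

Lemma nth_part_neq0 l i : (i < size l)%N -> nth 0%N l i != 0%N.
Proof. by move=> il; rewrite -lt0n; apply: (@part_gt0 _ l); rewrite mem_nth. Qed.

Lemma nth_part_inj l l' n : (size l <= n)%N -> (size l' <= n)%N ->
  (forall i, (i < n)%N -> nth 0%N l i = nth 0%N l' i) -> l = l'.
Proof.
move=> ln ln' e.
have le (a a' : part) : (size a' <= n)%N -> (forall i, (i < n)%N ->
  nth 0%N a i = nth 0%N a' i) ->
    (size a' <= size a)%N.
  move=> an' ea; rewrite leqNgt; apply/negP => aa'.
  have := nth_part_neq0 aa'; rewrite -ea ?nth_default //.
  exact: leq_trans aa' an'.
apply: val_inj; apply: (@eq_from_nth _ 0%N).
  by apply/eqP; rewrite eqn_leq !le // => i il; rewrite e.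
by move=> i il; apply: e; apply: leq_trans il ln.
Qed.

Lemma nth_part_sorted l i j : (i <= j)%N -> (nth 0 l j <= nth 0 l i)%N.
Proof.
move=> ij; have [lj|jl] := leqP (size l) j; first by rewrite nth_default.
case: l jl => s /= /andP[ss _] jl.
have tr : transitive geq by move=> y x z xy yz; exact: leq_trans yz xy.
have rf : reflexive geq by move=> x; exact: leqnn.
by apply: (sorted_leq_nth tr rf 0%N ss) => //; rewrite inE //; apply: leq_ltn_trans ij jl.
Qed.

(** * Exponent vectors as pairs of a partition and a permutation *)

Section Main.

Variable N : nat.
Local Notation A := {ffun 'I_N -> int}.
Implicit Types (al be : A) (s : 'S_N).

(** This is la + delta with delta = (N-1, ..., 0), so that subtracting [rev_ord j] gives the
    Jacobi-Trudi index la_i - i + j. *)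
Definition beta l : A := [ffun i : 'I_N => (nth 0 l i + rev_ord i)%N%:Z].

Lemma beta_decr l (i j : 'I_N) : (i < j)%N -> beta l j < beta l i.
Proof.
move=> ij; rewrite !ffunE ltz_nat /=.
by have := nth_part_sorted l (ltnW ij); have := ltn_ord j; lia.
Qed.

Lemma sdet_beta l : (size l <= N)%N -> sdet (beta l) = schur l.
Proof.
move=> lN; rewrite (schur_JT lN); congr (\det _); apply/matrixP => i j.
rewrite !mxE ffunE /=; have := ltn_ord i; have := ltn_ord j => jN iN.
case: ifP => c; last by rewrite hz_neg //; lia.
rewrite (_ : _ - _ = (nth 0 l i + j - i)%N%:Z) //; lia.
Qed.

Lemma sum_beta l : (size l <= N)%N ->
  \sum_i beta l i = (psize l)%:Z + \sum_(i < N) (i : nat)%:Z.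
Proof.
move=> lN; rewrite -(sum_nth_part lN) (big_morph Posz PoszD (erefl _)).
rewrite [X in _ + X](reindex_inj rev_ord_inj) /= -big_split.
by apply: eq_bigr => i _; rewrite ffunE PoszD.
Qed.

(** An increasing permutation satisfies i <= s i; applied to the inverse as well, this forces
    equality. *)
Lemma perm_mono s : (forall i j : 'I_N, (i < j)%N -> (s i < s j)%N) -> s = 1%g.
Proof.
have le (t : 'S_N) : (forall i j : 'I_N, (i < j)%N -> (t i < t j)%N) ->
  forall i : 'I_N, (i <= t i)%N.
  move=> mt [i iN]; elim: i iN => // i IH iN.
  have iN' : (i < N)%N by exact: ltnW.
  by apply: leq_ltn_trans (IH iN') _; apply: mt.
move=> ms; have ms' (i j : 'I_N) : (i < j)%N -> (s^-1%g i < s^-1%g j)%N.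
  move=> ij; rewrite ltnNge leq_eqVlt; apply/negP => /orP[/eqP/val_inj/perm_inj ji|/ms].
    by rewrite ji ltnn in ij.
  by rewrite !permKV; lia.
apply/permP => i; rewrite perm1; apply/val_inj/eqP; rewrite eqn_leq le // andbT.
by rewrite -{2}(permK s i) le.
Qed.

Definition beta_perm (x : part * 'S_N) : A := [ffun i => beta x.1 (x.2 i)].

Lemma beta_perm_inj (x y : part * 'S_N) : (size x.1 <= N)%N -> (size y.1 <= N)%N ->
  beta_perm x = beta_perm y -> x = y.
Proof.
case: x y => [l s] [l' s'] /= lN lN' /ffunP e.
have e' i : beta l ((s'^-1 * s)%g i) = beta l' i.
  by have := e (s'^-1%g i); rewrite !ffunE /= permM permKV.
have r1 : (s'^-1 * s)%g = 1%g.
  apply: perm_mono => i j ij; have := beta_decr l' ij; rewrite -!e'.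
  set p := (_ * _)%g; rewrite ltnNge leq_eqVlt => lt.
  apply/negP => /orP[/eqP/val_inj pp|/(beta_decr l)]; last by lia.
  by rewrite pp ltxx in lt.
have ss : s = s' by rewrite -[s](mulKVg s') r1 mulg1.
rewrite ss; congr (_, _); apply: (nth_part_inj lN lN') => i iN.
by have := e' (Ordinal iN); rewrite r1 perm1 !ffunE /=; lia.
Qed.

Lemma gtn_sorted_ge (t : seq nat) i : sorted gtn t -> (i < size t)%N ->
  (size t - i.+1 <= nth 0 t i)%N.
Proof.
elim: t i => // x t IH [|i] st /=; last first.
  by rewrite ltnS subSS; apply: IH; apply: path_sorted st.
move=> _; rewrite subn1 /=; case: t st IH => //= y t /andP[yx st] /(_ 0%N st isT) /=.
by rewrite subn1 /=; lia.
Qed.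

(** The zeros come last, so removing them moves no other entry, and the default value 0 replaces
    them. *)
Lemma nth_filter0 (q : seq nat) i : sorted geq q ->
  nth 0%N [seq x <- q | x != 0%N] i = nth 0%N q i.
Proof.
elim: q i => //= x q IH i sq; case: ifP => [_|/negbFE/eqP x0].
  by case: i => //= i; apply: IH; apply: path_sorted sq.
have q0 y : y \in x :: q -> y = 0%N.
  rewrite inE => /orP[/eqP -> //|yq]; move: sq; rewrite path_sortedE.
    by move=> /andP[/allP /(_ y yq) /=]; rewrite x0; lia.
  by move=> u v w vu uw; exact: leq_trans uw vu.
rewrite (_ : [seq _ <- _ | _] = [::]); last first.
  apply/nilP; rewrite /nilp size_filter -leqn0 leqNgt -has_count.
  by apply/hasPn => y yq; rewrite (q0 y) // inE yq orbT.
rewrite nth_nil; have [iq|qi] := ltnP i (size (x :: q)); last by rewrite nth_default.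
by rewrite (q0 (nth 0%N (x :: q) i)) // mem_nth.
Qed.

(** Sort the entries decreasingly and subtract delta: as they are distinct, the result [q] is weakly
    decreasing, and its nonzero entries form the partition. The inverse of the sorting permutation
    recovers [al]. *)
Lemma beta_perm_surj al : injective al -> (forall i, 0 <= al i) ->
  exists2 x : part * 'S_N, (size x.1 <= N)%N & al = beta_perm x.
Proof.
move=> ia a0; pose t := [tuple absz (al i) | i < N].
have ut : uniq t.
  by rewrite map_inj_uniq ?enum_uniq // => i j e; apply: ia; move: (a0 i) (a0 j) e; lia.
have : perm_eq (sort geq t) t by rewrite perm_sort.
move/tuple_permP => [p sp].
have tot_geq : total geq by move=> x y; exact: leq_total.
have tr : transitive geq by move=> y x z xy yz; exact: leq_trans yz xy.
have sg : sorted gtn (sort geq t).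
  have := sort_sorted tot_geq t; have : uniq (sort geq t) by rewrite sort_uniq.
  elim: (sort geq t) => // x r IH /= /andP[xr ur]; rewrite !path_sortedE //; last first.
    by move=> y u z uy yz; exact: ltn_trans yz uy.
  move=> /andP[/allP xa sr]; rewrite IH // andbT; apply/allP => y yr.
  have := xa _ yr => /=; rewrite leq_eqVlt => /orP[/eqP e|//].
  by rewrite -e yr in xr.
have nt (i : 'I_N) : nth 0%N (sort geq t) i = absz (al (p i)).
  by rewrite sp -(tnth_nth 0%N [tuple tnth t (p i) | i < N] i) !tnth_mktuple.
have sz : size (sort geq t) = N by rewrite size_sort size_tuple.
pose q := mkseq (fun i => nth 0%N (sort geq t) i - (N - i.+1))%N N.
have sq : sorted geq q.
  apply/(sortedP 0%N) => i; rewrite size_mkseq => iN; rewrite !nth_mkseq //;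
    last exact: ltnW.
  have /(sortedP 0%N)/(_ i) := sg; rewrite sz => /(_ iN) /=.
  by have := gtn_sorted_ge sg; rewrite sz => /(_ _ iN); lia.
have P : is_part [seq x <- q | x != 0%N].
  by rewrite /is_part sorted_filter // mem_filter.
exists (Part P, p^-1%g) => /=.
  by rewrite size_filter (leq_trans (count_size _ _)) // size_mkseq.
apply/ffunP => j; rewrite !ffunE /= nth_filter0 // nth_mkseq // nt permKV.
have := gtn_sorted_ge sg; rewrite sz => /(_ _ (ltn_ord (p^-1%g j)));
  rewrite nt permKV => le.
by rewrite subnK // gez0_abs.
Qed.

End Main.

(** * The differential equations of S *)

Lemma homog_schur l : homog (psize l) (schur l).
Proof.
move=> a al; apply/eqP; apply: contraNT al; rewrite -(sdet_beta (leqnn _)) => nz.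
by have := sdet_homog nz; rewrite sum_beta //; move: (\sum_(i < _) _) => z; lia.
Qed.

Lemma eqd_serS d M : (d <= M)%N -> eqd d serS (\sum_(a <- parts_upto M) schur a).
Proof.
move=> dM; apply: eqd_ssum; rewrite ?parts_upto_uniq // => a _.
rewrite mem_parts_upto -ltnNge => Ma; apply: homog_eqd (@homog_schur a) _.
exact: leq_ltn_trans dM Ma.
Qed.

(** The contributing vectors are the permuted [beta a] with [a] of size at most N, hence with at
    most N parts. The permutation contributes its sign to both [esgn] and [sdet], so each of the N!
    rearrangements yields [schur a]. *)
Lemma eqd_Stot N B : (N + \sum_(i < N) i <= B)%N -> eqd N (Stot N B) (N`!%:R *: serS).
Proof.
move=> NB l lN; rewrite coefZ (eqd_serS lN (leqnn _)) coef_sum.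
rewrite /Stot coef_sum; under eq_bigr do rewrite coefZ.
pose L := [seq beta_perm (a, s) | a <- parts_upto N, s <- enum {: 'S_N}].
have sz a : a \in parts_upto N -> (size a <= N)%N.
  by rewrite mem_parts_upto => al; apply: leq_trans al; exact: size_part.
have uL : uniq L.
  apply: allpairs_uniq; rewrite ?parts_upto_uniq ?enum_uniq //.
  move=> x y /allpairsP[[a s] /= [aP _ ->]] /allpairsP[[b t] /= [bP _ ->]].
  by apply: beta_perm_inj => /=; apply: sz.
transitivity (tot (fun al : {ffun 'I_N -> int} => esgn al * coef (sdet al) l)).
  symmetry; apply: tot_seq; first exact: box_uniq.
  move=> al; apply: contraNeq; rewrite mulf_eq0 negb_or => /andP[_ nz].
  apply: mem_box => i; have a0 := sdet_nonneg nz.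
  have := ge_entry i a0; rewrite (sdet_homog nz) -(big_morph Posz PoszD (erefl _)).
  by move: NB (a0 i); move: (\sum_(j < N) j)%N => z; lia.
rewrite (tot_seq uL); last first.
  move=> al; apply: contraNeq; rewrite mulf_eq0 negb_or => /andP[_ nz].
  have [[a s] /= aN eal] := beta_perm_surj (sdet_inj nz) (sdet_nonneg nz).
  apply/allpairsP; exists (a, s); split => //=; last by rewrite mem_enum.
  rewrite mem_parts_upto; move: nz; rewrite eal sdet_perm sdet_beta //.
  rewrite mulr_sign => nz; have {}nz : coef (schur a) l != 0.
    by move: nz; case: odd_perm; rewrite ?coefN ?oppr_eq0.
  apply: leq_trans lN; rewrite leqNgt; apply: contraNN nz => la.
  by rewrite homog_schur //; lia.
rewrite big_allpairs_dep mulr_sumr [LHS]big_seq [RHS]big_seq; apply: eq_bigr => a aP.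
rewrite big_enum /= (eq_bigr (fun=> coef (schur a) l)) => [|s _].
  by rewrite sumr_const card_Sn mulr_natl.
rewrite /esgn ifT; last by apply/forallP => i; rewrite !ffunE.
rewrite vsgn_perm vsgn_decr ?mulr1; last by move=> i j; apply: beta_decr.
rewrite sdet_perm (sdet_beta (sz _ aP)) mulr_sign.
by case: odd_perm; rewrite ?coefN ?expr0 ?mul1r // expr1 mulN1r opprK.
Qed.

(** At a given [l], S is replaced by [Stot] divided by N!. The choice N = n + psize l is the degree
    that [D n] reads and also the number of rows that [D_Stot] requires. *)
Lemma gauss_serS : gauss (fun n => (odd n)%:R) serS.
Proof.
split.
  rewrite (eqd_serS (leqnn 0)) // coef_sum (bigD1_seq pempty) ?mem_parts_upto
    ?parts_upto_uniq //=.
  rewrite big_seq_cond big1 ?addr0 => [|a /andP[aP an]];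
    first by rewrite /schur det_mx00 coef1 eqxx.
  by move: aP an; rewrite mem_parts_upto leqn0 psize0 => ->.
move=> n n0; apply: symserP => l.
pose N := (n + psize l)%N; pose B := (N + \sum_(i < N) i + n + n)%N.
have eN : eqd N serS (N`!%:R^-1 *: Stot N B).
  apply: eqd_sym; apply: (eqd_trans (eqdZ _ (@eqd_Stot N B _))); first by rewrite /B; lia.
  by rewrite scalerA mulVf ?scale1r // pnatr_eq0 -lt0n fact_gt0.
rewrite (eqd_Dn eN (leqnn _)) DZ coefZ D_Stot //; try by rewrite /B /N; lia.
have le : (psize l <= N)%N by rewrite leq_addl.
rewrite !coefD (eqdM (@eqd_refl _ (psum n)) eN le) -scalerAr !coefZ eN // coefZ.
by rewrite mulrDr mulrCA.
Qed.

(** * The identities *)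

Lemma newton_ser_ext c c' : c =1 c' -> newton_ser c = newton_ser c'.
Proof. by move=> e; congr newton_ser; apply: funext. Qed.

Definition aS n : rat := (odd n)%:R.
Definition aSH n : rat := aS n - 1.
Definition aSE n : rat := aS n - (-1) ^+ n.+1.

Lemma aSHE n : aSH n = - (~~ odd n)%:R.
Proof. by rewrite /aSH /aS; case: odd; rewrite ?subrr ?oppr0 // sub0r. Qed.

Lemma aSEE n : aSE n = (~~ odd n)%:R.
Proof.
by rewrite /aSE /aS -signr_odd /=; case: odd; rewrite ?subrr // sub0r opprK.
Qed.

Lemma gauss_ext (a a' : nat -> rat) f :
  (forall n, (0 < n)%N -> a n = a' n) -> gauss a f -> gauss a' f.
Proof. by move=> e [f0 fD]; split=> // n n0; rewrite -e // fD. Qed.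

Lemma gauss_SH : gauss aSH (serS * serH^-1).
Proof. exact: (gauss_newton_serV (fun=> 1) gauss_serS). Qed.

Lemma gauss_SE : gauss aSE (serS * serE^-1).
Proof. exact: (gauss_newton_serV (fun n => (-1) ^+ n.+1) gauss_serS). Qed.

Lemma serH_kron (a : nat -> rat) f : gauss a f -> serH *k f = f.
Proof.
move=> af; apply: (@gauss_unique a) => //.
apply: gauss_ext (@newton_ser_kron_gauss (fun=> 1) a f _ af) => n _;
  first by rewrite mul1r.
by rewrite expr1n.
Qed.

Lemma serE_kron (a b : nat -> rat) f g : (forall n, b n = (-1) ^+ n.+1 * a n) ->
  gauss a f -> gauss b g -> serE *k f = g.
Proof.
move=> ab af bg; apply: (@gauss_unique b) => //.
apply: gauss_ext (@newton_ser_kron_gauss (fun n => (-1) ^+ n.+1) a f _ af) => n _.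
  by rewrite ab.
by rewrite -exprM mulnC exprM sqrrN expr1n.
Qed.

Lemma serS_exp :
  serS = sexp (ssum [set n | (0 < n)%N]
               (fun n => (n.*2)%:R^-1 *: psum n ^+ 2
                         + (n.*2.-1)%:R^-1 *: psum n.*2.-1)).
Proof.
set f := ssum _ _.
have f0 : coef f pempty = 0.
  apply: coef_ssum0 => n _; rewrite coefD !coefZ coefX0 !coef_psum0 expr0n.
  by rewrite !mulr0 addr0.
apply: (gauss_unique gauss_serS); split; first by rewrite coef_sexp0.
move=> n n0; rewrite D_sexp // -mulr_algl; rewrite -[RHS]mulrDl; congr (_ * _).
have E i : (0 < i)%N -> D n (i.*2%:R^-1 *: psum i ^+ 2 + i.*2.-1%:R^-1 *: psum i.*2.-1)
   = (i == n)%:R *: psum n + (i.*2.-1 == n)%:R%:A.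
  move=> i0; rewrite linearD !linearZ /= DX expr1 !D_psum //; last by lia.
  congr (_ + _).
    rewrite eq_sym; have [->|_] := eqVneq i n; last first.
      by rewrite muln0 scale0r mulr0 !scaler0 scale0r.
    rewrite muln1 -scalerAr mulr1 !scalerA scale1r -mulrA -natrM mul2n mulrC.
    by rewrite divff ?scale1r // pnatr_eq0; lia.
  rewrite eq_sym; have [->|_] := eqVneq i.*2.-1 n; last first.
    by rewrite muln0 !scale0r scaler0.
  by rewrite muln1 scalerA mulVf // pnatr_eq0; lia.
(* p_n occurs in the term of index i = n through p_i^2 and, for odd n, in that of index i = (n+1)/2
   through p_(2i-1); both indices lie in 1, ..., n. *)
rewrite (@D_ssum n _ _ _ (iota 1 n)) ?iota_uniq // => [|i|i /= i0].
+ have -> : \sum_(i <- iota 1 n) D n (i.*2%:R^-1 *: psum i ^+ 2 + i.*2.-1%:R^-1 *: psum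
  i.*2.-1)
     = \sum_(i <- iota 1 n) ((i == n)%:R *: psum n + (i.*2.-1 == n)%:R%:A).
    rewrite big_seq [RHS]big_seq; apply: eq_bigr => i; rewrite mem_iota => /andP[i0 _].
    exact: E.
  rewrite big_split /=; congr (_ + _).
    rewrite (bigD1_seq n) ?iota_uniq ?mem_iota //=; last by lia.
    by rewrite eqxx scale1r big1 ?addr0 // => i /negPf ->; rewrite scale0r.
  rewrite /aS; case: (boolP (odd n)) => on; last first.
    rewrite scale0r big1_seq // => i; case: eqP => [e|_ _]; last by rewrite scale0r.
    by rewrite mem_iota; lia.
  rewrite (bigD1_seq n.+1./2) ?iota_uniq ?mem_iota //=; last by lia.
  rewrite (_ : (_ == n) = true); last by apply/eqP; lia.
  rewrite big1 ?addr0 // => i ii; case: eqP => [e|_]; last by rewrite scale0r.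
  by lia.
+ by rewrite mem_iota /=; lia.
+ rewrite mem_iota => ni; rewrite E //.
  rewrite (_ : (i == n) = false); last by apply/eqP; lia.
  rewrite (_ : (i.*2.-1 == n) = false); last by apply/eqP; lia.
  by rewrite !scale0r addr0.
Qed.

Lemma D_ssum_psum (P : pred nat) (F : nat -> symser) n :
  (forall i, P i -> (0 < i)%N) -> (0 < n)%N ->
  (forall i, P i -> i != n -> D n (F i) = 0) ->
  D n (ssum [set n | P n] F) = (P n)%:R *: D n (F n).
Proof.
move=> P0 n0 F0; rewrite (@D_ssum n _ _ _ (if P n then [:: n] else [::])) //.
- by case: ifP => _; rewrite ?big_seq1 ?big_nil ?scale1r ?scale0r.
- by case: ifP.
- by case: ifP => // Pn i; rewrite inE => /eqP ->.
- move=> i /= Pi; have [e|ni _] := eqVneq i n; last exact: F0.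
  by rewrite -e Pi mem_head.
Qed.

Lemma mehler_ssum (a b : nat -> rat) (P : pred nat) (F : nat -> symser) f g :
  gauss a f -> gauss b g -> (forall i, P i -> (0 < i)%N) ->
  (forall i, P i -> coef (F i) pempty = 0) ->
  (forall i n, P i -> i != n -> (0 < n)%N -> D n (F i) = 0) ->
  (forall n, (0 < n)%N -> ~~ P n -> a n * b n = 0 /\ a n ^+ 2 + b n ^+ 2 = 0) ->
  (forall n, (0 < n)%N -> P n -> (1 - psum n ^+ 2) ^+ 2 * D n (F n) =
     (a n * b n)%:A * (1 + psum n ^+ 2) + (a n ^+ 2 + b n ^+ 2)%:A * psum n) ->
  f *k g = serG * sexp (ssum [set n | P n] F).
Proof.
move=> fa gb P0 F0 Fn notP FD; apply: (@mehler a b) => //.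
  exact: coef_ssum0.
move=> n n0; rewrite D_ssum_psum // => [|i Pi ni]; last exact: Fn.
have [Pn|Pn] := boolP (P n); first by rewrite scale1r FD.
have [-> ->] := notP _ n0 Pn.
by rewrite !scale0r !mul0r addr0 mulr0.
Qed.

Lemma D_frac n q : coef q pempty = 0 -> D n (q / (1 - q)) = D n q * (1 - q)^-1 ^+ 2.
Proof.
move=> q0; have u := unit_1B q0; have := mulrV u.
rewrite DM D_inv // linearB /= D1 sub0r mulNr opprK.
move: (1 - q)^-1 (D n q) => r x e.
transitivity (x * r * ((1 - q) * r) + q * (x * r ^+ 2)); last by ring.
by rewrite e mulr1.
Qed.

Lemma unit_sq f : f \is a GRing.unit -> f ^+ 2 * f^-1 ^+ 2 = 1.
Proof. by move=> u; rewrite -exprMn mulrV // expr1n. Qed.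

Lemma opp_ssum (I : choiceType) (A : set I) (F : I -> symser) :
  - ssum A F = ssum A (fun i => - F i).
Proof.
apply: symserP => l; rewrite coefN /= -mulN1r mulr_fsumr.
by apply: eq_fsbigr => i _; rewrite mulN1r.
Qed.

Lemma sqr_1Bpp_1Bp n : (1 - psum n ^+ 2) ^+ 2 * (1 - psum n)^-1 ^+ 2 = (1 + psum n) ^+ 2.
Proof.
have -> : 1 - psum n ^+ 2 = (1 + psum n) * (1 - psum n) by ring.
by rewrite exprMn -mulrA (unit_sq (unit_1Bp n)) mulr1.
Qed.

Lemma sqr_1Bpp_1Dp n : (1 - psum n ^+ 2) ^+ 2 * (1 + psum n)^-1 ^+ 2 = (1 - psum n) ^+ 2.
Proof.
have -> : 1 - psum n ^+ 2 = (1 - psum n) * (1 + psum n) by ring.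
by rewrite exprMn -mulrA (unit_sq (unit_1Dp n)) mulr1.
Qed.

Lemma sqr_1Bpp_1Bpp n : (1 - psum n ^+ 2) ^+ 2 * (1 - psum n ^+ 2)^-1 ^+ 2 = 1.
Proof. exact: unit_sq (unit_1Bpp n). Qed.

Lemma D_frac1B n i : (0 < n)%N -> (0 < i)%N ->
  D n (i%:R^-1 *: (psum i / (1 - psum i))) = (i == n)%:R *: (1 - psum n)^-1 ^+ 2.
Proof.
move=> n0 i0; rewrite linearZ /= D_frac // D_psum // eq_sym.
have [e|_] := eqVneq i n; last by rewrite muln0 !scale0r mul0r scaler0.
by rewrite e muln1 mulr_algl scalerA mulVf ?pnatr_eq0 -?lt0n // !scale1r.
Qed.

Lemma D_frac1D n i : (0 < n)%N -> (0 < i)%N ->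
  D n (- (i%:R^-1 *: (psum i / (1 + psum i)))) = - ((i == n)%:R *: (1 + psum n)^-1 ^+ 2).
Proof.
move=> n0 i0; have -> : - (i%:R^-1 *: (psum i / (1 + psum i))) =
  i%:R^-1 *: (- psum i / (1 - (- psum i))) by rewrite opprK mulNr scalerN.
rewrite linearZ /= D_frac ?coefN ?coef_psum0 ?oppr0 // linearN /= D_psum // eq_sym opprK.
have [e|_] := eqVneq i n; last by rewrite muln0 !scale0r oppr0 mul0r scaler0.
by rewrite e muln1 mulNr mulr_algl scalerN scalerA mulVf ?pnatr_eq0 -?lt0n // !scale1r.
Qed.

Lemma D_frac_sqr n i : (0 < n)%N -> (0 < i)%N ->
  D n (i.*2%:R^-1 *: (psum i ^+ 2 / (1 - psum i ^+ 2))) =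
  (i == n)%:R *: (psum n * (1 - psum n ^+ 2)^-1 ^+ 2).
Proof.
move=> n0 i0; have q0 : coef (psum i ^+ 2) pempty = 0 by rewrite coefX0 expr0n.
rewrite linearZ /= (D_frac _ q0) DX expr1 D_psum // eq_sym.
have [e|_] := eqVneq i n; last by rewrite muln0 !scale0r mulr0 scaler0 mul0r scaler0.
rewrite e muln1 -scalerAr mulr1 scalerA -scalerAl scalerA -natrM mul2n.
by rewrite mulVf ?scale1r // pnatr_eq0; lia.
Qed.

(** Mehler's right-hand side is 1 + p_n^2 + 2 p_n = (1 + p_n)^2 for odd n and 0 for even n. Divided
    by (1 - p_n^2)^2 it leaves 1 / (1 - p_n)^2, which is D_n of p_n / (n (1 - p_n)). *)
Lemma kron_Modd : serS *k serS = serG * serModd.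
Proof.
apply: (mehler_ssum gauss_serS gauss_serS) =>
  [[]//|i _|i n oi ni n0|n n0 /negPf on|n n0 on].
- by rewrite coefZ coefM0 mul0r mulr0.
- by rewrite D_frac1B ?(negPf ni) ?scale0r //; case: i oi ni.
- by rewrite /aS on expr0n mulr0 addr0.
rewrite D_frac1B // eqxx scale1r sqr_1Bpp_1Bp /aS on expr1n mulr1 -mulr2n scale1r
  scaler_nat; ring.
Qed.

(** For S against S/H or S/E exactly one of a_n, b_n is nonzero, depending on the parity of n; only
    the summand p_n of Mehler's right-hand side survives. *)
Lemma kron_N (a b : nat -> rat) f g : gauss a f -> gauss b g ->
  (forall n, a n * b n = 0) -> (forall n, a n ^+ 2 + b n ^+ 2 = 1) ->
  f *k g = serG * serN.
Proof.
move=> fa gb ab ab2.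
apply: (mehler_ssum fa gb) => [//|i _|i n i0 ni n0|n -> //|n n0 _].
- by rewrite coefZ coefM0 coefX0 expr0n mul0r mulr0.
- by rewrite D_frac_sqr ?(negPf ni) ?scale0r.
rewrite D_frac_sqr // eqxx scale1r ab ab2 scale0r mul0r add0r scale1r mul1r.
by rewrite mulrCA sqr_1Bpp_1Bpp mulr1.
Qed.

Lemma kron_Meven (a : nat -> rat) f : gauss a f ->
  (forall n, a n ^+ 2 = (~~ odd n)%:R) -> f *k f = serG * serMeven.
Proof.
move=> fa a2; apply: (mehler_ssum (P := fun n => (0 < n)%N && ~~ odd n) fa fa)
  => [i /andP[]//|i _|i n /andP[i0 _] ni n0|n -> /= /negPf on|n n0 /andP[_ on]].
- by rewrite coefZ coefM0 mul0r mulr0.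
- by rewrite D_frac1B ?(negPf ni) ?scale0r.
- by rewrite -expr2 a2 on addr0.
rewrite D_frac1B // eqxx scale1r sqr_1Bpp_1Bp -expr2 a2 on scale1r -mulr2n scaler_nat;
  ring.
Qed.

(** For even n the constants are -1 and 1, so Mehler's right-hand side is -(1 + p_n^2) + 2 p_n = -(1
    - p_n)^2, which accounts for the denominators 1 + p_n in [serP]. *)
Lemma kron_P : (serS * serH^-1) *k (serS * serE^-1) = serG * serP.
Proof.
rewrite /serP opp_ssum.
apply: (mehler_ssum (P := fun n => (0 < n)%N && ~~ odd n) gauss_SH gauss_SE)
  => [i /andP[]//|i _|i n /andP[i0 _] ni n0|n -> /= /negPf on|n n0 /andP[_ on]].
- by rewrite coefN coefZ coefM0 mul0r mulr0 oppr0.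
- by rewrite D_frac1D ?(negPf ni) ?scale0r ?oppr0.
- by rewrite aSHE aSEE on oppr0 expr0n mul0r addr0.
rewrite D_frac1D // eqxx scale1r mulrN sqr_1Bpp_1Dp aSHE aSEE on mulr1 sqrrN expr1n.
rewrite scaleN1r -mulr2n scaler_nat; ring.
Qed.

Theorem theorem1 :
  (* the closed forms of the three basic series *)
  [/\ serH = sexp (ssum [set n | (0 < n)%N] (fun n => n%:R^-1 *: psum n)),
      serE = sexp (ssum [set n | (0 < n)%N]
               (fun n => ((-1) ^+ n.+1 / n%:R) *: psum n))
    & serS = sexp (ssum [set n | (0 < n)%N]
               (fun n => (n.*2)%:R^-1 *: psum n ^+ 2
                         + (n.*2.-1)%:R^-1 *: psum n.*2.-1))]
  /\ commutative kron
  /\ [/\ serH *k serH = serH,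
         serH *k serE = serE,
         serH *k serS = serS,
         serH *k (serS * serH^-1) = serS * serH^-1
       & serH *k (serS * serE^-1) = serS * serE^-1]
  /\ [/\ serE *k serE = serH,
         serE *k serS = serS,
         serE *k (serS * serH^-1) = serS * serE^-1
       & serE *k (serS * serE^-1) = serS * serH^-1]
  /\ [/\ serS *k serS = serG * serModd,
         serS *k (serS * serH^-1) = serG * serN
       & serS *k (serS * serE^-1) = serG * serN]
  /\ [/\ (serS * serH^-1) *k (serS * serH^-1) = serG * serMeven,
         (serS * serH^-1) *k (serS * serE^-1) = serG * serP
       & (serS * serE^-1) *k (serS * serE^-1) = serG * serMeven].
Proof.
have sgn n : (-1) ^+ n.+1 = (-1) ^+ (~~ odd n) :> rat by rewrite -signr_odd.
split; last split; last split; last split; last split.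
- split; last exact: serS_exp; last exact: (newton_ser_exp (fun n => (-1) ^+ n.+1)).
  rewrite [LHS](newton_ser_exp (fun=> 1)); congr (sexp (ssum _ _)).
  by apply: funext => n; rewrite mul1r.
- exact: kronC.
- split.
  + rewrite [LHS](newton_ser_kron (fun=> 1) (fun=> 1)).
    by apply: newton_ser_ext => n; rewrite mulr1.
  + rewrite [LHS](newton_ser_kron (fun=> 1) (fun n => (-1) ^+ n.+1)).
    by apply: newton_ser_ext => n; rewrite mul1r.
  + exact: serH_kron gauss_serS.
  + exact: serH_kron gauss_SH.
  + exact: serH_kron gauss_SE.
- split.
  + rewrite [LHS](newton_ser_kron (fun n => (-1) ^+ n.+1) (fun n => (-1) ^+ n.+1)).
    by apply: newton_ser_ext => n; rewrite -expr2 -exprM mulnC exprM sqrrN expr1n.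
  + apply: serE_kron gauss_serS gauss_serS => n.
    by rewrite sgn /aS; case: odd; rewrite ?mulr0 // mulr1.
  + apply: serE_kron gauss_SH gauss_SE => n.
    by rewrite sgn aSHE aSEE; case: odd; rewrite ?oppr0 ?mulr0 // mulN1r opprK.
  + apply: serE_kron gauss_SE gauss_SH => n.
    by rewrite sgn aSHE aSEE; case: odd; rewrite ?oppr0 ?mulr0 // mulN1r.
- split; first exact: kron_Modd.
  + apply: (kron_N gauss_serS gauss_SH) => n; rewrite aSHE /aS;
      by case: odd; rewrite ?oppr0 ?mulr0 ?mul0r ?sqrrN ?expr0n ?expr1n ?addr0 ?add0r.
  + apply: (kron_N gauss_serS gauss_SE) => n; rewrite aSEE /aS;
      by case: odd; rewrite ?oppr0 ?mulr0 ?mul0r ?sqrrN ?expr0n ?expr1n ?addr0 ?add0r.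
- split; last apply: (kron_Meven gauss_SE) => n.
  + apply: (kron_Meven gauss_SH) => n; rewrite aSHE sqrrN.
    by case: odd; rewrite ?expr0n ?expr1n.
  + exact: kron_P.
  + by rewrite aSEE; case: odd; rewrite ?expr0n ?expr1n.
Qed.
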